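(* For all $\tau$ in the upper half-plane $\mathbb{H}$, with $u,v,w$ as in the context, $$\frac{u^2}{v}-\frac{v^2}{w}+\frac{w^2}{u}=0$$ and $$\frac{v}{u^2}-\frac{w}{v^2}+\frac{u}{w^2}=\frac{\eta(\tau)}{\eta^2(7\tau)}\,j_7^*(\tau)^{1/3},$$ where $j_7^*(\tau)^{1/3}$ denotes the cube root of $j_7^*(\tau)$ which is meromorphic on $\mathbb{H}$ and whose $q$-expansion begins $q^{-1/3}(1+O(q))$.
   Context: Let $\tau\in\mathbb{H}$, $q=e^{2\pi i\tau}$, and for real $\alpha$ write $q^{\alpha}=e^{2\pi i\alpha\tau}$. Define $u=q^{1/56}\prod_{k\ge0}(1-q^{7k+3})(1-q^{7k+4})(1-q^{7k+7})$, $v=q^{9/56}\prod_{k\ge0}(1-q^{7k+2})(1-q^{7k+5})(1-q^{7k+7})$, $w=q^{25/56}\prod_{k\ge0}(1-q^{7k+1})(1-q^{7k+6})(1-q^{7k+7})$ (equivalently $u=q^{1/56}f(-q^3,-q^4)$, $v=q^{9/56}f(-q^2,-q^5)$, $w=q^{25/56}f(-q,-q^6)$ with Ramanujan's $f(a,b)=\sum_{n\in\mathbb{Z}}a^{n(n+1)/2}b^{n(n-1)/2}$). Let $\eta(\tau)=q^{1/24}\prod_{n\ge1}(1-q^n)$ be the Dedekind eta function and $j_7^*(\tau)=\left(\frac{\eta(\tau)}{\eta(7\tau)}\right)^4+13+49\left(\frac{\eta(7\tau)}{\eta(\tau)}\right)^4$. *)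

(* Defs.v *)
From Stdlib Require Import Reals.
From Coquelicot Require Import Coquelicot Complex.
Open Scope R_scope.

Definition cexp (z : C) : C :=
  Cmult (RtoC (exp (Re z))) (Cplus (RtoC (cos (Im z))) (Cmult Ci (RtoC (sin (Im z))))).

Definition qpow (alpha : R) (tau : C) : C :=
  cexp (Cmult (RtoC (2 * PI * alpha)) (Cmult Ci tau)).

Fixpoint cpow (z : C) (n : nat) : C :=
  match n with O => RtoC 1 | S m => Cmult (cpow z m) z end.

Fixpoint pprod (a : nat -> C) (N : nat) : C :=
  match N with O => RtoC 1 | S n => Cmult (pprod a n) (a n) end.

Definition Cprod (a : nat -> C) : C :=
  lim (T := C_CompleteNormedModule) (filtermap (pprod a) eventually).

Definition upper_half (tau : C) : Prop := 0 < Im tau.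

Definition omq (m : nat) (tau : C) : C := Cminus (RtoC 1) (qpow (INR m) tau).

Definition u (tau : C) : C :=
  Cmult (qpow (1/56) tau)
    (Cprod (fun k => Cmult (Cmult (omq (7*k+3) tau) (omq (7*k+4) tau)) (omq (7*k+7) tau))).

Definition v (tau : C) : C :=
  Cmult (qpow (9/56) tau)
    (Cprod (fun k => Cmult (Cmult (omq (7*k+2) tau) (omq (7*k+5) tau)) (omq (7*k+7) tau))).

Definition w (tau : C) : C :=
  Cmult (qpow (25/56) tau)
    (Cprod (fun k => Cmult (Cmult (omq (7*k+1) tau) (omq (7*k+6) tau)) (omq (7*k+7) tau))).

Definition eta (tau : C) : C :=
  Cmult (qpow (1/24) tau) (Cprod (fun n => omq (S n) tau)).

Definition j7star (tau : C) : C :=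
  let r := Cdiv (eta tau) (eta (Cmult (RtoC 7) tau)) in
  Cplus (Cplus (cpow r 4) (RtoC 13)) (Cmult (RtoC 49) (cpow (Cinv r) 4)).

Definition holo_at (f : C -> C) (z : C) : Prop :=
  ex_derive (K := C_AbsRing) (V := C_NormedModule) f z.

(* c is "the" cube root of j7* on H that is meromorphic (here: holomorphic,
   since j7* is holomorphic on H) with q-expansion q^{-1/3}(1 + O(q)). *)
Definition j7star_cube_root (c : C -> C) : Prop :=
  (forall tau, upper_half tau -> holo_at c tau) /\
  (forall tau, upper_half tau -> cpow (c tau) 3 = j7star tau) /\
  (exists M T : R, forall tau, T < Im tau ->
      Cmod (Cminus (Cmult (qpow (1/3) tau) (c tau)) (RtoC 1)) <= M * Cmod (qpow 1 tau)).

(* Main.v *)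
(** Let theta(z) = prod_(k >= 0) (1 - q^(7k) z) (1 - q^(7k+7) / z) (1 - q^(7k+7)), so that u,
    v, w are theta(q^3), theta(q^2), theta(q) up to powers of q. By the Jacobi triple product
    theta is a two-sided series, and splitting the double series of theta(xy) theta(x/y) by
    parity writes it as a 2x2 determinant, so that the Pluecker relation gives the three-term
    relation; at the points q^j it is the first identity A - B + C = 0, with A = u^2/v, B =
    v^2/w, C = w^2/u.

    The three-term relation also provides a Weierstrass coordinate X with X(x) - X(y) = y
    theta(xy) theta(x/y) / (theta(x)^2 theta(y)^2). The cubic whose roots are the values of X
    at the half periods -1, s, -s (s^2 = q^7) is known by its values at q, q^2, q^3
    (duplication formula), and its discriminant is q^7 / (16 prod (1 - q^(7n))^12). Comparing
    the two gives B^3 - 8 B^2 C + 5 B C^2 + C^3 = eta(tau)^5 / eta(7 tau)^2: this is the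
    factor t^3 - 8 t^2 + 5 t + 1 of the discriminant of the universal curve with a 7-torsion
    point. With A B C = eta(tau) eta(7 tau)^2 and 1/A - 1/B + 1/C = (A^2 + A C + C^2) / (A B
    C), the second identity, cubed, becomes a polynomial identity in A and C, and eta(7 tau)^2
    / eta(tau) times the left-hand side is the required cube root. *)

Require Import Defs.
From Stdlib Require Import Reals Lra Lia ZArith.
From Coquelicot Require Import Coquelicot Complex.
From mathcomp Require Import ssreflect.
Open Scope R_scope.
Open Scope C_scope.

(** * Limits and dominated series in C *)

(** The septic relation becomes elementary algebra for the following reason: a monic cubic is
    determined by three of its values, and doubling permutes the classes of q, q^2, q^3 modulo
    q^(7Z) up to inversion, so the duplication formula expresses these values as monomials in the
    same three theta values that enter u, v, w.

    On the analytic side the obstacle is the cube root: extracting one on the half-plane means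
    choosing a branch. The candidate is therefore an explicit quotient of theta functions, and its
    cube, its holomorphy and its leading term at the cusp are separate verifications. An infinite
    product is awkward to differentiate, but the triple product turns u, v, w into a power of q
    times a series of terms +-q^(a_n) with a_n >= |n|. The same holds for eta, whose product is the
    theta product with parameters q^3 and q. Such series are differentiated termwise with explicit
    remainders, and their constant term 1 gives the O(q) estimate. *)

Definition Clim (s : nat -> C) (l : C) : Prop :=
  is_lim_seq (fun n => Cmod (s n - l)) 0.

Lemma Clim_squeeze s l (e : nat -> R) :
  (forall n, Cmod (s n - l) <= e n) -> is_lim_seq e 0 -> Clim s l.
Proof.
move=> h he. apply: (is_lim_seq_le_le (fun _ => 0%R) _ e) => //; last exact: is_lim_seq_const.
by move=> n; split; [apply: Cmod_ge_0|].
Qed.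

Lemma Clim_ext s t l : (forall n, s n = t n) -> Clim s l -> Clim t l.
Proof. by move=> h; apply: is_lim_seq_ext => n; rewrite h. Qed.

Lemma Clim_const l : Clim (fun _ => l) l.
Proof.
apply: (is_lim_seq_ext (fun _ => 0%R)); last exact: is_lim_seq_const.
move=> n. replace (l - l) with (RtoC 0) by ring. by rewrite Cmod_0.
Qed.

Lemma Clim_plus s t l m : Clim s l -> Clim t m -> Clim (fun n => s n + t n) (l + m).
Proof.
move=> hs ht. apply: (Clim_squeeze _ _ (fun n => Cmod (s n - l) + Cmod (t n - m))%R).
  move=> n. replace (s n + t n - (l + m)) with ((s n - l) + (t n - m)) by ring.
  exact: Cmod_triangle.
replace (Finite 0) with (Finite (0 + 0)) by (congr Finite; ring).
exact: is_lim_seq_plus'.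
Qed.

Lemma Clim_mult s t l m : Clim s l -> Clim t m -> Clim (fun n => s n * t n) (l * m).
Proof.
move=> hs ht.
apply: (Clim_squeeze _ _ (fun n => Cmod (s n - l) * Cmod (t n - m)
   + (Cmod (s n - l) * Cmod m + Cmod l * Cmod (t n - m)))%R).
  move=> n.
  replace (s n * t n - l * m) with ((s n - l)*(t n - m) + ((s n - l) * m + l * (t n - m))) by ring.
  rewrite -!Cmod_mult. apply: Rle_trans; first exact: Cmod_triangle.
  apply: Rplus_le_compat_l. exact: Cmod_triangle.
replace (Finite 0) with (Finite (0 * 0 + (0 * Cmod m + Cmod l * 0))) by (congr Finite; ring).
apply: is_lim_seq_plus'; first exact: is_lim_seq_mult'.
apply: is_lim_seq_plus'; apply: is_lim_seq_mult' => //; exact: is_lim_seq_const.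
Qed.

Lemma Clim_scal a s l : Clim s l -> Clim (fun n => a * s n) (a * l).
Proof. by apply: Clim_mult; exact: Clim_const. Qed.

Lemma Clim_minus s t l m : Clim s l -> Clim t m -> Clim (fun n => s n - t n) (l - m).
Proof.
move=> hs ht. replace (l - m) with (l + (-(1)) * m) by ring.
apply: (Clim_ext (fun n => s n + (-(1)) * t n)); first by move=> n; ring.
by apply: Clim_plus => //; exact: Clim_scal.
Qed.

Lemma Clim_bound s l (M : R) : (forall n, Cmod (s n) <= M) -> Clim s l -> Cmod l <= M.
Proof.
move=> h hs.
have H : is_lim_seq (fun n => M + Cmod (s n - l))%R (M + 0)%R.
  apply: is_lim_seq_plus' => //; exact: is_lim_seq_const.
rewrite Rplus_0_r in H.
apply: (is_lim_seq_le (fun _ => Cmod l) _ (Cmod l) M _ _ H); last exact: is_lim_seq_const.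
move=> n. replace l with (s n + -(s n - l)) at 1 by ring.
apply: Rle_trans; first exact: Cmod_triangle.
rewrite Cmod_opp. have := h n. lra.
Qed.

Lemma Clim_unique s l m : Clim s l -> Clim s m -> l = m.
Proof.
move=> hl hm.
have H : Clim (fun n => s n - s n) (l - m) by exact: Clim_minus.
have h0 : Cmod (l - m) <= 0.
  apply: (Clim_bound _ _ _ _ H) => n.
  replace (s n - s n) with (RtoC 0) by ring. rewrite Cmod_0. lra.
have e : l - m = 0 by apply: Cmod_eq_0; apply: Rle_antisym => //; exact: Cmod_ge_0.
replace l with (l - m + m) by ring. by rewrite e Cplus_0_l.
Qed.

Lemma Clim_subseq s l (phi : nat -> nat) :
  filterlim phi eventually eventually -> Clim s l -> Clim (fun n => s (phi n)) l.
Proof. by move=> h hs; apply: (is_lim_seq_subseq _ _ phi h hs). Qed.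

Lemma filterlim_ge_id (phi : nat -> nat) :
  (forall n, (n <= phi n)%nat) -> filterlim phi eventually eventually.
Proof. move=> h P [N hN]; exists N => n hn. apply: hN. have := h n. lia. Qed.

Lemma Clim_incr s l : Clim (fun n => s (S n)) l <-> Clim s l.
Proof. rewrite /Clim. symmetry. exact: (is_lim_seq_incr_1 (fun n => Cmod (s n - l))). Qed.

Fixpoint csum (g : nat -> C) (N : nat) : C :=
  match N with O => 0 | S n => csum g n + g n end.

Lemma csum_S g n : csum g (S n) = csum g n + g n.
Proof. by []. Qed.

(** Built from the total real [Series]; it is the limit of [csum g] as soon as both components
    converge, which [geom_dom] ensures for [0 <= r < 1]. *)
Definition CS (g : nat -> C) : C :=
  (Series (fun k => Re (g k)), Series (fun k => Im (g k))).

Lemma csum_ext g h N : (forall k, (k < N)%nat -> g k = h k) -> csum g N = csum h N.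
Proof.
elim: N => //= N IH H. rewrite IH ?H //. move=> k hk. apply: H. lia.
Qed.

Lemma csum_plus g h N : csum (fun k => g k + h k) N = csum g N + csum h N.
Proof. elim: N => /= [|N ->]; ring. Qed.

Lemma csum_scal a g N : csum (fun k => a * g k) N = a * csum g N.
Proof. elim: N => /= [|N ->]; ring. Qed.

(** All series and products below converge at least geometrically, so this single kind of majorant
    serves for convergence, tails and exchanges of limits. *)
Definition geom_dom (K r : R) (g : nat -> C) : Prop :=
  forall k, Cmod (g k) <= K * r ^ k.

Lemma ex_series_geom_scal (K r : R) : 0 <= r < 1 -> ex_series (fun k => K * r ^ k)%R.
Proof.
move=> hr. apply: (ex_series_scal_l K (fun k => r ^ k)%R). apply: ex_series_geom.
by rewrite Rabs_pos_eq; lra.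
Qed.

Lemma is_lim_geom_scal (K r : R) : 0 <= r < 1 -> is_lim_seq (fun n => K * r ^ n)%R 0.
Proof.
move=> hr. replace (Finite 0) with (Finite (K * 0)) by (congr Finite; ring).
apply: is_lim_seq_mult'; first exact: is_lim_seq_const.
apply: is_lim_seq_geom. by rewrite Rabs_pos_eq; lra.
Qed.

Lemma Cmod_le_Rabs (z : C) : Cmod z <= Rabs (Re z) + Rabs (Im z).
Proof.
case: z => x y /=. rewrite /Cmod /=.
apply: Rsqr_incr_0_var; last by have := Rabs_pos x; have := Rabs_pos y; lra.
rewrite Rsqr_sqrt; last by nra.
rewrite /Rsqr. have := Rabs_pos x; have := Rabs_pos y.
have -> : (x * (x * 1) + y * (y * 1) = Rabs x * Rabs x + Rabs y * Rabs y)%R.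
  rewrite -!Rabs_mult !Rabs_pos_eq; nra.
nra.
Qed.

Lemma im_le_Cmod (z : C) : Rabs (Im z) <= Cmod z.
Proof.
apply: Rle_trans; last exact: Rmax_Cmod. case: z => x y /=. exact: Rmax_r.
Qed.

Lemma CS_lim_ex g : ex_series (fun k => Re (g k)) -> ex_series (fun k => Im (g k)) ->
  Clim (csum g) (CS g).
Proof.
move=> /Series_correct hr /Series_correct hi.
apply/Clim_incr.
have eR n : Re (csum g (S n)) = sum_n (fun k => Re (g k)) n.
  elim: n => [|n IH]; first by rewrite sum_O /=; case: (g 0%nat) => x y /=; ring.
  rewrite sum_Sn -IH /plus /=. by [].
have eI n : Im (csum g (S n)) = sum_n (fun k => Im (g k)) n.
  elim: n => [|n IH]; first by rewrite sum_O /=; case: (g 0%nat) => x y /=; ring.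
  rewrite sum_Sn -IH /plus /=. by [].
apply: (Clim_squeeze _ _ (fun n => Rabs (sum_n (fun k => Re (g k)) n - Series (fun k => Re (g k)))
   + Rabs (sum_n (fun k => Im (g k)) n - Series (fun k => Im (g k))))%R).
  move=> n. rewrite -eR -eI. exact: Cmod_le_Rabs.
have key (a : nat -> R) : is_series a (Series a) ->
    is_lim_seq (fun n => Rabs (sum_n a n - Series a))%R 0.
  move=> h.
  have -> : Finite 0 = Rbar_abs (Finite (Series a - Series a)).
    by rewrite /= Rminus_diag Rabs_R0.
  apply: is_lim_seq_abs. apply: is_lim_seq_minus'; [exact: h|exact: is_lim_seq_const].
replace (Finite 0) with (Finite (0 + 0)) by (congr Finite; ring).
by apply: is_lim_seq_plus'; apply: key.
Qed.

Lemma CS_lim K r g : 0 <= r < 1 -> geom_dom K r g -> Clim (csum g) (CS g).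
Proof.
move=> hr hg. apply: CS_lim_ex; apply: (ex_series_le _ (fun k => K * r ^ k)%R);
  try exact: ex_series_geom_scal; move=> n; apply: Rle_trans (hg n).
- exact: re_le_Cmod.
- exact: im_le_Cmod.
Qed.

Lemma CS_is K r g l : 0 <= r < 1 -> geom_dom K r g -> Clim (csum g) l -> CS g = l.
Proof. by move=> hr hg hl; apply: Clim_unique (CS_lim _ _ _ hr hg) hl. Qed.

Lemma CS_ext g h : (forall k, g k = h k) -> CS g = CS h.
Proof. move=> H. by rewrite /CS; congr pair; apply: Series_ext => k; rewrite H. Qed.

Lemma geom_dom_ge0 K r g : geom_dom K r g -> 0 <= K.
Proof. move=> h. have := h 0%nat; have := Cmod_ge_0 (g 0%nat); rewrite /=. lra. Qed.

Lemma csum_block K r g M n : 0 <= r < 1 -> geom_dom K r g ->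
  Cmod (csum g (M + n) - csum g M) <= K * r ^ M * (1 - r ^ n) / (1 - r).
Proof.
move=> hr hg. elim: n => [|n IH].
  rewrite Nat.add_0_r. replace (csum g M - csum g M) with (RtoC 0) by ring.
  rewrite Cmod_0 /=. right. field. lra.
rewrite Nat.add_succ_r /=.
replace (csum g (M+n) + g (M+n)%nat - csum g M) with ((csum g (M+n) - csum g M) + g (M+n)%nat) by ring.
apply: Rle_trans; first exact: Cmod_triangle.
apply: Rle_trans; first by apply: Rplus_le_compat; [exact: IH|exact: hg].
rewrite pow_add. right. field. lra.
Qed.

Lemma CS_tail K r g M : 0 <= r < 1 -> geom_dom K r g ->
  Cmod (CS g - csum g M) <= K * r ^ M / (1 - r).
Proof.
move=> hr hg.
have H : Clim (fun n => csum g (M + n) - csum g M) (CS g - csum g M).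
  apply: Clim_minus; last exact: Clim_const.
  apply: (Clim_subseq (csum g)); last exact: CS_lim hr hg.
  by apply: filterlim_ge_id => n; lia.
apply: Clim_bound H => n. apply: Rle_trans; first exact: csum_block hr hg.
have hK := geom_dom_ge0 _ _ _ hg.
rewrite /Rdiv. apply: Rmult_le_compat_r; first by apply/Rlt_le/Rinv_0_lt_compat; lra.
have h1 : 0 <= r ^ n by apply: pow_le; lra.
have h2 : 0 <= r ^ M by apply: pow_le; lra.
have := Rmult_le_pos _ _ hK h2. nra.
Qed.

Lemma csum_lim (g : nat -> nat -> C) h M :
  (forall k, Clim (fun N => g N k) (h k)) -> Clim (fun N => csum (g N) M) (csum h M).
Proof.
move=> H. elim: M => [|M IH] /=; first exact: Clim_const. exact: Clim_plus.
Qed.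

Lemma geom_dom_lim K r (g : nat -> nat -> C) h :
  (forall N, geom_dom K r (g N)) -> (forall k, Clim (fun N => g N k) (h k)) -> geom_dom K r h.
Proof. move=> hg hh k. by apply: (Clim_bound (fun N => g N k)) => // N; apply: hg. Qed.

(** Dominated convergence: beyond some index M the common geometric tails are small, and the finite
    sums up to M converge term by term. *)
Lemma tannery K r (g : nat -> nat -> C) h : 0 <= r < 1 ->
  (forall N, geom_dom K r (g N)) -> (forall k, Clim (fun N => g N k) (h k)) ->
  Clim (fun N => CS (g N)) (CS h).
Proof.
move=> hr hg hh. have hd := geom_dom_lim _ _ _ _ hg hh.
apply/is_lim_seq_spec => eps /=.
(* The factor 2 covers the two tails, that of [g n] and that of [h]. *)
have /is_lim_seq_spec h1 := is_lim_geom_scal (2 * K / (1 - r)) r hr.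
have hp : (0 < eps / 2)%R by apply: Rdiv_lt_0_compat; [apply: cond_pos|lra].
have [M hM] := h1 (mkposreal _ hp). rewrite /= in hM.
have {}hM := hM M (Nat.le_refl _). rewrite Rminus_0_r in hM.
have /is_lim_seq_spec h2 := csum_lim _ _ M hh.
have [N hN] := h2 (mkposreal _ hp). rewrite /= in hN.
exists N => n hn. have {}hN := hN n hn.
rewrite Rminus_0_r Rabs_pos_eq in hN; last exact: Cmod_ge_0.
rewrite Rminus_0_r Rabs_pos_eq; last exact: Cmod_ge_0.
replace (CS (g n) - CS h) with ((CS (g n) - csum (g n) M) + ((csum (g n) M - csum h M) + - (CS h - csum h M))) by ring.
apply: Rle_lt_trans; first exact: Cmod_triangle.
have t1 := CS_tail _ _ _ M hr (hg n). have t2 := CS_tail _ _ _ M hr hd.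
have t3 := Cmod_triangle (csum (g n) M - csum h M) (- (CS h - csum h M)).
rewrite Cmod_opp in t3.
have := Rle_abs (2 * K / (1 - r) * r ^ M).
have : (2 * K / (1 - r) * r ^ M = K * r ^ M / (1 - r) + K * r ^ M / (1 - r))%R by field; lra.
lra.
Qed.

Lemma CS_finite (g : nat -> C) N : (forall k, (N <= k)%nat -> g k = 0) -> Clim (csum g) (csum g N).
Proof.
move=> h.
have e n : csum g (N + n) = csum g N.
  elim: n => [|n IH]; first by rewrite Nat.add_0_r.
  rewrite Nat.add_succ_r /= IH h; [ring|lia].
apply: (is_lim_seq_ext_loc (fun _ => 0%R)); last exact: is_lim_seq_const.
exists N => n hn. have -> : n = (N + (n - N))%nat by lia.
rewrite e. replace (csum g N - csum g N) with (RtoC 0) by ring. by rewrite Cmod_0.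
Qed.

Lemma CS_plus K r g h : 0 <= r < 1 -> geom_dom K r g -> geom_dom K r h ->
  CS (fun k => g k + h k) = CS g + CS h.
Proof.
move=> hr hg hh. apply: (CS_is (K + K) r) => //.
  move=> k. apply: Rle_trans; first exact: Cmod_triangle.
  have := hg k; have := hh k. lra.
apply: (Clim_ext (fun n => csum g n + csum h n)); first by move=> n; rewrite csum_plus.
by apply: Clim_plus; apply: CS_lim hr _.
Qed.

Lemma CS_scal K r a g : 0 <= r < 1 -> geom_dom K r g -> CS (fun k => a * g k) = a * CS g.
Proof.
move=> hr hg. apply: (CS_is (Cmod a * K) r) => //.
  move=> k. rewrite Cmod_mult Rmult_assoc. apply: Rmult_le_compat_l; [exact: Cmod_ge_0|exact: hg].
apply: (Clim_ext (fun n => a * csum g n)); first by move=> n; rewrite csum_scal.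
by apply: Clim_scal; apply: CS_lim hr _.
Qed.

(** * Infinite products *)

(** The abstract [lim] in [Cprod] is controlled by completeness only for a Cauchy filter.
    Convergence in modulus makes the filter Cauchy, and uniqueness of limits identifies the two
    values. *)
Lemma Cprod_lim a l : Clim (pprod a) l -> Cprod a = l.
Proof.
move=> h. rewrite /Cprod. set F := filtermap (pprod a) eventually.
have FF : ProperFilter F by apply: filtermap_proper_filter; exact: eventually_filter.
have evt x (eps : posreal) : Clim (pprod a) x -> F (fun y => Cmod (y - x) < eps).
  move=> /is_lim_seq_spec /(_ eps) [N hN]; exists N => n hn; have := hN n hn.
  rewrite Rminus_0_r Rabs_pos_eq //. exact: Cmod_ge_0.
have hc : cauchy (T := C_CompleteNormedModule) F.
  move=> eps; exists l. have [N hN] := evt l eps h; exists N => n hn.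
  apply: C_NormedModule_mixin_compat1. exact: (hN n hn).
have H := complete_cauchy (T := C_CompleteNormedModule) F FF hc.
apply: (Clim_unique (pprod a)) => //.
apply/is_lim_seq_spec => eps.
(* A ball of the uniform structure of [C] lies in a disc whose radius is larger by the factor
   [sqrt 2 <= 2], hence [eps / 2]. *)
have hp : (0 < eps / 2)%R by apply: Rdiv_lt_0_compat; [apply: cond_pos|lra].
have [N hN] := H (mkposreal _ hp). exists N => n hn.
rewrite Rminus_0_r Rabs_pos_eq; last exact: Cmod_ge_0.
have := C_NormedModule_mixin_compat2 _ _ (mkposreal _ hp) (hN n hn).
rewrite /minus /plus /opp /= => h1. apply: Rlt_le_trans; first exact: h1.
have h2 : sqrt 2 <= 2.
  rewrite -{2}(sqrt_square 2); last lra. apply: sqrt_le_1_alt. lra.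
have := cond_pos eps. nra.
Qed.

Lemma pprod_ext f g N : (forall k, f k = g k) -> pprod f N = pprod g N.
Proof. by move=> h; elim: N => //= N ->; rewrite h. Qed.

Lemma pprod_S f n : pprod f (S n) = pprod f n * f n.
Proof. by []. Qed.

Lemma pprod_mult f g N : pprod (fun k => f k * g k) N = pprod f N * pprod g N.
Proof. by elim: N => /= [|N ->]; ring. Qed.

Lemma pprod_add f m n : pprod f (m + n) = pprod f m * pprod (fun i => f (m + i)%nat) n.
Proof.
elim: n => [|n IH] /=; first by rewrite Nat.add_0_r; ring.
rewrite Nat.add_succ_r /= IH. ring.
Qed.

Lemma pprod_group m f N :
  pprod (fun k => pprod (fun i => f (m * k + i)%nat) m) N = pprod f (m * N).
Proof.
elim: N => [|N IH]; first by rewrite Nat.mul_0_r.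
by rewrite Nat.mul_succ_r pprod_add /= IH.
Qed.

Definition prod_dom (K r : R) (f : nat -> C) : Prop := geom_dom K r (fun k => f k - 1).

(** From [1 + x <= exp x], the exponents add up to a partial geometric sum. *)
Lemma pprod_bound K r f N : 0 <= r < 1 -> prod_dom K r f ->
  Cmod (pprod f N) <= exp (K / (1 - r)).
Proof.
move=> hr hf. have hK := geom_dom_ge0 _ _ _ hf.
apply: (Rle_trans _ (exp (K * (1 - r ^ N) / (1 - r)))).
  elim: N => [|N IH] /=.
    rewrite Cmod_1. replace (K * (1 - 1) / (1 - r))%R with 0%R by (field; lra).
    rewrite exp_0. lra.
  rewrite Cmod_mult.
  have h1 : Cmod (f N) <= exp (K * r ^ N).
    apply: (Rle_trans _ (1 + K * r ^ N)); last exact: exp_ineq1_le.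
    replace (f N) with (1 + (f N - 1)) by ring.
    apply: Rle_trans; first exact: Cmod_triangle. rewrite Cmod_1.
    apply: Rplus_le_compat_l. exact: hf.
  have -> : (K * (1 - r * r ^ N) / (1 - r) = K * (1 - r ^ N) / (1 - r) + K * r ^ N)%R by field; lra.
  rewrite exp_plus. apply: Rmult_le_compat => //; exact: Cmod_ge_0.
have h0 : 0 <= r ^ N by apply: pow_le; lra.
case: (Rle_lt_or_eq_dec (K * (1 - r ^ N) / (1 - r)) (K / (1 - r))).
- apply: Rmult_le_compat_r; first by apply/Rlt_le/Rinv_0_lt_compat; lra. nra.
- by move=> h; apply/Rlt_le/exp_increasing.
- move=> ->. lra.
Qed.

(** Reduces convergence of products to that of series: by [pprod_bound] the summands inherit the
    geometric majorant of [f k - 1]. *)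
Lemma pprod_telescope f N : pprod f N = 1 + csum (fun k => pprod f k * (f k - 1)) N.
Proof. elim: N => [|N IH] /=; first ring. rewrite {1}IH. ring_simplify. rewrite IH. ring. Qed.

Lemma prod_dom_lim K r f : 0 <= r < 1 -> prod_dom K r f -> Clim (pprod f) (Cprod f).
Proof.
move=> hr hf.
have hd : geom_dom (exp (K / (1 - r)) * K) r (fun k => pprod f k * (f k - 1)).
  move=> k. rewrite Cmod_mult Rmult_assoc.
  apply: Rmult_le_compat; try exact: Cmod_ge_0; [exact: pprod_bound hr hf|exact: hf].
have H : Clim (pprod f) (1 + CS (fun k => pprod f k * (f k - 1))).
  apply: (Clim_ext (fun N => 1 + csum (fun k => pprod f k * (f k - 1)) N)).
    by move=> n; rewrite -pprod_telescope.
  apply: Clim_plus; [exact: Clim_const|exact: CS_lim hr hd].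
by rewrite (Cprod_lim _ _ H).
Qed.

Lemma Cprod_ext f g : (forall k, f k = g k) -> Cprod f = Cprod g.
Proof.
move=> h. have e : pprod f = pprod g.
  apply: FunctionalExtensionality.functional_extensionality => N. exact: pprod_ext.
by rewrite /Cprod e.
Qed.

Lemma Cprod_mult K K' r f g : 0 <= r < 1 -> prod_dom K r f -> prod_dom K' r g ->
  Cprod (fun k => f k * g k) = Cprod f * Cprod g.
Proof.
move=> hr hf hg. apply: Cprod_lim.
apply: (Clim_ext (fun N => pprod f N * pprod g N)); first by move=> n; rewrite pprod_mult.
apply: Clim_mult; [exact: prod_dom_lim hr hf|exact: prod_dom_lim hr hg].
Qed.

(** The partial products of the blocks form a subsequence of those of [f]. With m = 2, 3, 7 this
    compares products in a base with products in its m-th power. *)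
Lemma Cprod_group K r m f : (0 < m)%nat -> 0 <= r < 1 -> prod_dom K r f ->
  Cprod (fun k => pprod (fun i => f (m * k + i)%nat) m) = Cprod f.
Proof.
move=> hm hr hf. apply: Cprod_lim.
apply: (Clim_ext (fun N => pprod f (m * N))); first by move=> n; rewrite pprod_group.
apply: (Clim_subseq (pprod f)); last exact: prod_dom_lim hr hf.
by apply: filterlim_ge_id => n; nia.
Qed.

Lemma Cprod_S K r f : 0 <= r < 1 -> prod_dom K r f -> Cprod f = f 0%nat * Cprod (fun k => f (S k)).
Proof.
move=> hr hf.
have hf' : prod_dom (K * r) r (fun k => f (S k)).
  move=> k. have := hf (S k). by rewrite /= Rmult_assoc.
apply: Cprod_lim; apply/Clim_incr.
apply: (Clim_ext (fun N => f 0%nat * pprod (fun k => f (S k)) N)).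
  move=> n. rewrite (pprod_add f 1 n) /=. ring.
apply: Clim_scal. exact: prod_dom_lim hr hf'.
Qed.

Lemma geom_dom_eventually r g N : 0 < r ->
  (exists K, forall k, (N <= k)%nat -> Cmod (g k) <= K * r ^ k) -> exists K, geom_dom K r g.
Proof.
move=> hr. elim: N => [|N IH] [K h]; first by exists K => k; apply: h; lia.
apply: IH. exists (Rmax K (Cmod (g N) / r ^ N)) => k hk.
have hp : (0 < r ^ k)%R by apply: pow_lt.
case: (Nat.eq_dec N k) => [e|ne].
  rewrite -e in hp *. apply: (Rle_trans _ (Cmod (g N) / r ^ N * r ^ N)); first by right; field; lra.
  apply: Rmult_le_compat_r; [lra|exact: Rmax_r].
apply: Rle_trans; first by apply: h; lia.
apply: Rmult_le_compat_r; [lra|exact: Rmax_l].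
Qed.

(** Far out the factors have modulus at least 1/2, so inversion at most doubles their distance from
    1; the finitely many earlier factors only enlarge the constant. *)
Lemma prod_dom_inv K r (f : nat -> C) : 0 < r < 1 -> prod_dom K r f -> (forall k, f k <> 0) ->
  exists K', prod_dom K' r (fun k => / f k).
Proof.
move=> hr hf h0. have hr' : 0 <= r < 1 by lra.
have /is_lim_seq_spec h1 := is_lim_geom_scal K r hr'.
have hp : (0 < /2)%R by lra.
have [N hN] := h1 (mkposreal _ hp). rewrite /= in hN.
apply: (geom_dom_eventually _ _ N); first lra.
exists (2 * K)%R => k hk.
have {}hN := hN k hk. rewrite Rminus_0_r in hN.
have h2 := Rle_abs (K * r ^ k).
have h3 := hf k.
have h4 : (/2 <= Cmod (f k))%R.
  have := Cmod_triangle (f k) (-(f k - 1)). rewrite Cmod_opp.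
  replace (f k + - (f k - 1)) with (RtoC 1) by ring. rewrite Cmod_1. lra.
replace (/ f k - 1) with (-(f k - 1) / f k); last by field; exact: h0.
rewrite Cmod_div ?Cmod_opp; last exact: h0.
apply: (Rle_trans _ (Cmod (f k - 1) * 2)); last lra.
apply: Rmult_le_compat_l; first exact: Cmod_ge_0.
replace 2%R with (/ / 2)%R by lra. by apply: Rinv_le_contravar.
Qed.

Lemma pprod_inv (f : nat -> C) N : (forall k, f k <> 0) -> pprod (fun k => / f k) N = / pprod f N.
Proof.
move=> h0. elim: N => [|N IH] /=; first by field.
have hN : pprod f N <> 0.
  elim: N {IH} => [|N IH] /=; first by move=> /RtoC_inj; lra. exact: Cmult_neq_0.
rewrite IH. field. by split.
Qed.

(** The product of the inverses converges too, which is why a dominated product of nonzero factors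
    is nonzero. *)
Lemma Cprod_inv_mult K r (f : nat -> C) : 0 < r < 1 -> prod_dom K r f -> (forall k, f k <> 0) ->
  Cprod f * Cprod (fun k => / f k) = 1.
Proof.
move=> hr hf h0. have hr' : 0 <= r < 1 by lra.
have [K' hK'] := prod_dom_inv _ _ _ hr hf h0.
rewrite -(Cprod_mult _ _ _ _ _ hr' hf hK').
apply: Cprod_lim. apply: (Clim_ext (fun _ => RtoC 1)); last exact: Clim_const.
elim=> //= n <-. rewrite Cinv_r; [by rewrite Cmult_1_r|exact: h0].
Qed.

Lemma Cprod_neq0 K r (f : nat -> C) : 0 < r < 1 -> prod_dom K r f -> (forall k, f k <> 0) -> Cprod f <> 0.
Proof.
move=> hr hf h0 e0. have := Cprod_inv_mult _ _ _ hr hf h0.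
rewrite e0 Cmult_0_l. by move=> /RtoC_inj; lra.
Qed.

(** * Two-sided series *)

Lemma RtoC_neq0 (x : R) : x <> 0%R -> RtoC x <> 0.
Proof. by move=> hx /RtoC_inj. Qed.

Lemma C1_neq0 : RtoC 1 <> 0.
Proof. apply: RtoC_neq0; lra. Qed.

Lemma Cinv_neq0 (z : C) : z <> 0 -> / z <> 0.
Proof.
move=> h e. apply: C1_neq0. by rewrite -(Cinv_r z h) e Cmult_0_r.
Qed.

Lemma Cdiv_neq0 (x y : C) : x <> 0 -> y <> 0 -> x / y <> 0.
Proof. by move=> hx hy; apply: Cmult_neq_0 => //; apply: Cinv_neq0. Qed.

Lemma Copp_neq0 (x : C) : x <> 0 -> - x <> 0.
Proof. move=> h e; apply: h. replace x with (- - x) by ring. rewrite e. ring. Qed.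

Ltac nz := repeat first [assumption | exact: C1_neq0 | apply: Cdiv_neq0 | apply: Cinv_neq0 | apply: Copp_neq0
  | apply: Cmult_neq_0 | apply: Cpow_nz].

Lemma Cinv_unique (x y : C) : x * y = 1 -> / x = y.
Proof.
move=> h. have hx : x <> 0 by move=> e; apply: C1_neq0; rewrite -h e Cmult_0_l.
replace y with (x * y / x) by (field; done). rewrite h. by field.
Qed.

Definition zpow (z : C) (n : Z) : C :=
  match n with
  | Z0 => 1
  | Zpos p => z ^ Pos.to_nat p
  | Zneg p => / z ^ Pos.to_nat p
  end.

Lemma zpow_of_nat z n : zpow z (Z.of_nat n) = z ^ n.
Proof. case: n => //= n. by rewrite SuccNat2Pos.id_succ. Qed.

Lemma zpow_opp_of_nat z n : zpow z (- Z.of_nat n) = / z ^ n.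
Proof. case: n => [|n]; first by rewrite /=; field. by rewrite /= SuccNat2Pos.id_succ. Qed.

(** Reduces the laws of integer powers to quotients of natural powers. *)
Lemma Z_diff_nat (n : Z) : exists a b, n = (Z.of_nat a - Z.of_nat b)%Z.
Proof. exists (Z.to_nat n), (Z.to_nat (- n)). lia. Qed.

Lemma zpow_diff (z : C) a b : z <> 0 -> zpow z (Z.of_nat a - Z.of_nat b) = z ^ a / z ^ b.
Proof.
move=> hz. case: (Nat.le_ge_cases b a) => h.
  have -> : (Z.of_nat a - Z.of_nat b = Z.of_nat (a - b))%Z by lia.
  rewrite zpow_of_nat. have {2}-> : a = (a - b + b)%nat by lia.
  rewrite Cpow_add_r. field. exact: Cpow_nz.
have -> : (Z.of_nat a - Z.of_nat b = - Z.of_nat (b - a))%Z by lia.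
rewrite zpow_opp_of_nat. have {2}-> : b = (b - a + a)%nat by lia.
rewrite Cpow_add_r. field. by split; exact: Cpow_nz.
Qed.

Lemma zpow_add (z : C) m n : z <> 0 -> zpow z (m + n) = zpow z m * zpow z n.
Proof.
move=> hz. have [a [b ->]] := Z_diff_nat m. have [c [d ->]] := Z_diff_nat n.
have -> : (Z.of_nat a - Z.of_nat b + (Z.of_nat c - Z.of_nat d) = Z.of_nat (a + c) - Z.of_nat (b + d))%Z by lia.
rewrite !zpow_diff // !Cpow_add_r. field. by split; exact: Cpow_nz.
Qed.

Lemma zpow_neq0 (z : C) n : z <> 0 -> zpow z n <> 0.
Proof.
by move=> hz; case: n => [|p|p] /=; [exact: C1_neq0|exact: Cpow_nz|apply/Cinv_neq0/Cpow_nz].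
Qed.

Lemma zpow_opp (z : C) n : z <> 0 -> zpow z (- n) = / zpow z n.
Proof.
move=> hz. have h0 := zpow_neq0 _ n hz.
have e : zpow z (- n) * zpow z n = 1 by rewrite -zpow_add //; have -> : (- n + n = 0)%Z by lia.
replace (zpow z (- n)) with (zpow z (- n) * zpow z n / zpow z n) by (field; done).
rewrite e. by field.
Qed.

Lemma zpow_1_r z : zpow z 1 = z.
Proof. rewrite /=. ring. Qed.

Lemma zpow_mul_l (x y : C) n : x <> 0 -> y <> 0 -> zpow (x * y) n = zpow x n * zpow y n.
Proof.
move=> hx hy. have hxy := Cmult_neq_0 _ _ hx hy. have [a [b ->]] := Z_diff_nat n.
rewrite !zpow_diff // !Cpow_mult_l. field. by split; exact: Cpow_nz.
Qed.

Lemma zpow_mul_r (z : C) m n : z <> 0 -> zpow z (m * n) = zpow (zpow z m) n.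
Proof.
move=> hz. have hm := zpow_neq0 _ m hz.
elim/Z.peano_ind: n => [|n IH|n IH]; first by rewrite Z.mul_0_r.
  rewrite -Z.add_1_r Z.mul_add_distr_l !zpow_add // IH Z.mul_1_r. by rewrite zpow_1_r.
rewrite -Z.sub_1_r Z.mul_sub_distr_l !zpow_add // IH Z.mul_1_r !zpow_opp //. by rewrite zpow_1_r.
Qed.

Lemma zpow_inv (z : C) n : z <> 0 -> zpow (/ z) n = / zpow z n.
Proof.
move=> hz. rewrite -[in LHS](zpow_1_r z) -zpow_opp // -zpow_mul_r //.
have -> : (-1 * n = - n)%Z by lia. exact: zpow_opp.
Qed.

Lemma zpow_2 z : zpow z 2 = z * z.
Proof. rewrite /=. ring. Qed.

Definition zdom (K r : R) (f : Z -> C) : Prop :=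
  forall n, Cmod (f n) <= K * r ^ Z.abs_nat n.

(** The pairs {k, -k-1} with k >= 0 partition Z, so no index is singled out, and the first N pairs
    are exactly the indices from -N to N-1. *)
Definition fz (f : Z -> C) (k : nat) : C := f (Z.of_nat k) + f (- Z.of_nat k - 1)%Z.

Definition ZS (f : Z -> C) : C := CS (fz f).

Lemma ZS_ext f g : (forall n, f n = g n) -> ZS f = ZS g.
Proof. by move=> h; apply: CS_ext => k; rewrite /fz !h. Qed.

Lemma zdom_ge0 K r f : zdom K r f -> 0 <= K.
Proof. move=> h. have := h 0%Z; have := Cmod_ge_0 (f 0%Z); rewrite /=. lra. Qed.

Lemma pow_le_compat_exp r m n : 0 <= r <= 1 -> (m <= n)%nat -> r ^ n <= r ^ m.
Proof.
move=> hr h. have -> : n = (m + (n - m))%nat by lia.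
rewrite pow_add. have h1 : 0 <= r ^ m by apply: pow_le; lra.
have : r ^ (n - m) <= 1 by rewrite -(pow1 (n - m)); apply: pow_incr; lra.
nra.
Qed.

Lemma fz_dom K r f : 0 <= r <= 1 -> zdom K r f -> geom_dom (2 * K) r (fz f).
Proof.
move=> hr hf k. apply: Rle_trans; first exact: Cmod_triangle.
have hK := zdom_ge0 _ _ _ hf.
have h1 := hf (Z.of_nat k). have h2 := hf (- Z.of_nat k - 1)%Z.
have e1 : Z.abs_nat (Z.of_nat k) = k by lia.
have e2 : Z.abs_nat (- Z.of_nat k - 1) = S k by lia.
rewrite e1 in h1. rewrite e2 /= in h2.
have h3 : 0 <= r ^ k by apply: pow_le; lra.
have h4 : 0 <= K * r ^ k by apply: Rmult_le_pos.
nra.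
Qed.

Lemma ZS_lim K r f : 0 <= r < 1 -> zdom K r f -> Clim (csum (fz f)) (ZS f).
Proof. by move=> hr hf; apply: (CS_lim (2 * K) r) => //; apply: fz_dom => //; lra. Qed.

Lemma ZS_plus K r f g : 0 <= r < 1 -> zdom K r f -> zdom K r g ->
  ZS (fun n => f n + g n) = ZS f + ZS g.
Proof.
move=> hr hf hg. rewrite /ZS -(CS_plus (2 * K) r) //; try (apply: fz_dom => //; lra).
apply: CS_ext => k. rewrite /fz. ring.
Qed.

Lemma ZS_scal K r a f : 0 <= r < 1 -> zdom K r f -> ZS (fun n => a * f n) = a * ZS f.
Proof.
move=> hr hf. rewrite /ZS -(CS_scal (2 * K) r) //; try (apply: fz_dom => //; lra).
apply: CS_ext => k. rewrite /fz. ring.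
Qed.

Lemma zdom_scal K r a f : zdom K r f -> zdom (Cmod a * K) r (fun n => a * f n).
Proof.
move=> hf n. rewrite Cmod_mult Rmult_assoc. apply: Rmult_le_compat_l; [exact: Cmod_ge_0|exact: hf].
Qed.

Lemma zdom_le K K' r f : 0 <= r -> K <= K' -> zdom K r f -> zdom K' r f.
Proof.
move=> hr hK hf n. apply: Rle_trans; first exact: hf.
apply: Rmult_le_compat_r => //. exact: pow_le.
Qed.

Lemma zdom_comp K r (f : Z -> C) (phi : Z -> Z) : 0 <= r <= 1 ->
  (forall n, Z.abs_nat n <= Z.abs_nat (phi n))%nat -> zdom K r f -> zdom K r (fun n => f (phi n)).
Proof.
move=> hr hphi hf n. apply: Rle_trans; first exact: hf.
apply: Rmult_le_compat_l; first exact: (zdom_ge0 _ _ _ hf). exact: pow_le_compat_exp.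
Qed.

Lemma zdom_shift K r f a : 0 < r <= 1 -> zdom K r f ->
  zdom (K / r ^ Z.abs_nat a) r (fun n => f (n + a)%Z).
Proof.
move=> hr hf n. apply: Rle_trans; first exact: hf.
have hK := zdom_ge0 _ _ _ hf.
have h1 : (0 < r ^ Z.abs_nat a)%R by apply: pow_lt; lra.
rewrite /Rdiv Rmult_assoc. apply: Rmult_le_compat_l => //.
apply: (Rmult_le_reg_l (r ^ Z.abs_nat a)) => //.
rewrite -Rmult_assoc Rinv_r; last lra. rewrite Rmult_1_l -pow_add.
apply: pow_le_compat_exp; [lra|lia].
Qed.

Lemma zdom_to0 K r f (phi : nat -> Z) : 0 <= r < 1 -> (forall n, n <= Z.abs_nat (phi n))%nat ->
  zdom K r f -> Clim (fun n => f (phi n)) 0.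
Proof.
move=> hr hphi hf. apply: (Clim_squeeze _ _ (fun n => K * r ^ n)%R); last exact: is_lim_geom_scal.
move=> n. replace (f (phi n) - 0) with (f (phi n)) by ring.
apply: Rle_trans; first exact: hf.
apply: Rmult_le_compat_l; first exact: (zdom_ge0 _ _ _ hf). apply: pow_le_compat_exp => //. lra.
Qed.

(** The shift moves the window of summation from [-N, N-1] to [-N+1, N]: the partial sums differ by
    the two boundary terms [f N] and [f (-N)], which tend to 0. *)
Lemma ZS_succ K r f : 0 < r < 1 -> zdom K r f -> ZS (fun n => f (n + 1)%Z) = ZS f.
Proof.
move=> hr hf. have hr' : 0 <= r < 1 by lra.
have hf' : zdom (K / r ^ Z.abs_nat 1) r (fun n => f (n + 1)%Z) by apply: zdom_shift => //; lra.
apply: (Clim_unique _ _ _ (ZS_lim _ _ _ hr' hf')).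
apply: (Clim_ext (fun N => csum (fz f) N + f (Z.of_nat N) - f (- Z.of_nat N)%Z)).
  elim=> [|N IH]; first by rewrite /=; ring.
  rewrite [csum (fz (fun n => f (n + 1)%Z)) (S N)]/= -IH /fz /=.
  have -> : (Z.of_nat N + 1 = Z.of_nat (S N))%Z by lia.
  have -> : (- Z.of_nat N - 1 + 1 = - Z.of_nat N)%Z by lia.
  have -> : (- Z.of_nat N - 1 = - Z.of_nat (S N))%Z by lia.
  have -> : Z.pos (Pos.of_succ_nat N) = Z.of_nat (S N) by lia.
  have -> : Z.neg (Pos.of_succ_nat N) = (- Z.of_nat (S N))%Z by lia.
  ring.
replace (ZS f) with (ZS f + 0 - 0) by ring.
apply: Clim_minus; first apply: Clim_plus; first exact: ZS_lim hr' hf.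
  by apply: (zdom_to0 K r f Z.of_nat) => // n; lia.
by apply: (zdom_to0 K r f (fun n => - Z.of_nat n)%Z) => // n; lia.
Qed.

Lemma ZS_shift K r f a : 0 < r < 1 -> zdom K r f -> ZS (fun n => f (n + a)%Z) = ZS f.
Proof.
move=> hr. elim/Z.peano_ind: a K f => [|a IH|a IH] K f hf.
- by apply: ZS_ext => n; rewrite Z.add_0_r.
- rewrite -(ZS_succ K r f) //.
  have hf' : zdom (K / r ^ Z.abs_nat 1) r (fun n => f (n + 1)%Z) by apply: zdom_shift => //; lra.
  rewrite -(IH _ _ hf'). apply: ZS_ext => n. congr f. lia.
- have hf' : zdom (K / r ^ Z.abs_nat (-1)) r (fun n => f (n + -1)%Z) by apply: zdom_shift => //; lra.
  rewrite -(ZS_ext (fun n => (fun m => f (m + -1)%Z) (n + 1)%Z) f); last first.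
    by move=> n /=; congr f; lia.
  rewrite (ZS_succ _ _ _ hr hf') -(IH _ _ hf'). apply: ZS_ext => n. congr f. lia.
Qed.

(** The window [-2N, 2N-1] consists of the even numbers 2n and the odd numbers 2n+1 with n in
    [-N, N-1], so the identity already holds for partial sums. *)
Lemma ZS_even_odd K r f : 0 < r < 1 -> zdom K r f ->
  ZS f = ZS (fun n => f (2 * n)%Z) + ZS (fun n => f (2 * n + 1)%Z).
Proof.
move=> hr hf. have hr' : 0 <= r < 1 by lra.
have he : zdom K r (fun n => f (2 * n)%Z) by apply: zdom_comp hf; [lra|lia].
have ho : zdom K r (fun n => f (2 * n + 1)%Z) by apply: zdom_comp hf; [lra|lia].
apply: (Clim_unique (fun N => csum (fz f) (2 * N))).
  apply: (Clim_subseq (csum (fz f))); last exact: ZS_lim hr' hf.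
  by apply: filterlim_ge_id => n; lia.
apply: (Clim_ext (fun N => csum (fz (fun n => f (2 * n)%Z)) N + csum (fz (fun n => f (2 * n + 1)%Z)) N)).
  elim=> [|N IH]; first by rewrite /=; ring.
  have -> : (2 * S N = S (S (2 * N)))%nat by lia.
  rewrite !csum_S -IH /fz.
  have -> : Z.of_nat (2 * N) = (2 * Z.of_nat N)%Z by lia.
  have -> : Z.of_nat (S (2 * N)) = (2 * Z.of_nat N + 1)%Z by lia.
  have -> : (2 * (- Z.of_nat N - 1) = - (2 * Z.of_nat N + 1) - 1)%Z by lia.
  have -> : (- (2 * Z.of_nat N + 1) - 1 + 1 = - (2 * Z.of_nat N) - 1)%Z by lia.
  ring.
by apply: Clim_plus; apply: ZS_lim hr' _.
Qed.

Lemma ZS_tannery K r (g : nat -> Z -> C) h : 0 <= r < 1 ->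
  (forall N, zdom K r (g N)) -> (forall k, Clim (fun N => g N k) (h k)) ->
  Clim (fun N => ZS (g N)) (ZS h).
Proof.
move=> hr hg hh. apply: (tannery (2 * K) r) => // [N|k].
  apply: fz_dom => //; lra.
exact: Clim_plus.
Qed.

Lemma ZS_bound K r f : 0 <= r < 1 -> zdom K r f -> Cmod (ZS f) <= 2 * K / (1 - r).
Proof.
move=> hr hf.
have hd : geom_dom (2 * K) r (fz f) by apply: fz_dom => //; lra.
have := CS_tail _ _ _ 0%nat hr hd. rewrite /= Rmult_1_r -/(ZS f).
by replace (ZS f - 0) with (ZS f) by ring.
Qed.

Lemma csum_fz_dom K r f N : 0 <= r < 1 -> zdom K r f -> Cmod (csum (fz f) N) <= 2 * K / (1 - r).
Proof.
move=> hr hf.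
have hd : geom_dom (2 * K) r (fz f) by apply: fz_dom => //; lra.
have := csum_block _ _ _ 0%nat N hr hd. rewrite /= Rmult_1_r.
replace (csum (fz f) N - 0) with (csum (fz f) N) by ring. move=> h; apply: Rle_trans h _.
rewrite /Rdiv. apply: Rmult_le_compat_r; first by apply/Rlt_le/Rinv_0_lt_compat; lra.
have := geom_dom_ge0 _ _ _ hd. have : 0 <= r ^ N by apply: pow_le; lra. nra.
Qed.

Lemma csum_dom K r (g : nat -> Z -> C) N : 0 <= r ->
  (forall k, zdom K r (g k)) -> zdom (INR N * K) r (fun n => csum (fun k => g k n) N).
Proof.
move=> hr hg. elim: N => [|N IH] n.
  rewrite /= Cmod_0 !Rmult_0_l. lra.
rewrite S_INR [csum _ _]/=. apply: Rle_trans; first exact: Cmod_triangle.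
have := IH n. have := hg N n. lra.
Qed.

Lemma csum_ZS K r (g : nat -> Z -> C) N : 0 <= r < 1 -> (forall k, zdom K r (g k)) ->
  csum (fun k => ZS (g k)) N = ZS (fun n => csum (fun k => g k n) N).
Proof.
move=> hr hg.
have hK := zdom_ge0 _ _ _ (hg 0%nat).
elim: N => [|N IH].
  rewrite -[LHS](Cmult_0_l (ZS (g 0%nat))) -(ZS_scal K r) //. by apply: ZS_ext => n /=; ring.
rewrite /= IH -(ZS_plus (INR N * K + K) r) //.
- apply: (zdom_le (INR N * K)); [lra|lra|]. apply: csum_dom => //; lra.
- apply: (zdom_le K); [lra| |exact: hg]. have := pos_INR N. nra.
Qed.

(** A finite sum commutes with a series; the bound by a product of geometric terms then lets
    Tannery's theorem pass to the limit. *)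
Lemma ZS_fubini K r (F : Z -> Z -> C) : 0 <= r < 1 ->
  (forall m n, Cmod (F m n) <= K * r ^ Z.abs_nat m * r ^ Z.abs_nat n) ->
  ZS (fun m => ZS (fun n => F m n)) = ZS (fun n => ZS (fun m => F m n)).
Proof.
move=> hr hF.
have hK : 0 <= K.
  have := hF 0%Z 0%Z; have := Cmod_ge_0 (F 0%Z 0%Z); rewrite /=; lra.
have hp n : 0 <= r ^ n by apply: pow_le; lra.
have h1 n : r ^ n <= 1 by apply: (pow_le_compat_exp r 0 n); [lra|lia].
have hrow m : zdom (K * r ^ Z.abs_nat m) r (F m) by move=> n; exact: hF.
have hcol n : zdom (K * r ^ Z.abs_nat n) r (fun m => F m n).
  move=> m. apply: Rle_trans; first exact: hF. right; ring.
have hrow' m : zdom K r (F m).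
  apply: (zdom_le _ K) (hrow m); first lra. have := h1 (Z.abs_nat m). nra.
have hs : zdom (2 * K / (1 - r)) r (fun m => ZS (F m)).
  move=> m. apply: Rle_trans; first exact: ZS_bound hr (hrow m).
  right; field; lra.
apply: (Clim_unique _ _ _ (ZS_lim _ _ _ hr hs)).
apply: (Clim_ext (fun N => ZS (fun n => csum (fz (fun m => F m n)) N))).
  move=> N. rewrite -(csum_ZS (K + K) r (fun k n => F (Z.of_nat k) n + F (- Z.of_nat k - 1)%Z n)) //.
    apply: csum_ext => k _. rewrite (ZS_plus K r) //.
  move=> k n. apply: Rle_trans; first exact: Cmod_triangle.
  have := hrow' (Z.of_nat k) n. have := hrow' (- Z.of_nat k - 1)%Z n. lra.
apply: (ZS_tannery (2 * K / (1 - r)) r) => //.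
  move=> N n. apply: Rle_trans; first exact: csum_fz_dom hr (hcol n).
  right; field; lra.
move=> n. exact: ZS_lim hr (hcol n).
Qed.

(** The term is the |n|-th power of s^|n| y or s^|n| / y, whose modulus is eventually below any
    prescribed r. The freedom in r is used in [Gam_mul]. *)
Lemma gauss_dom (s y : C) r : s <> 0 -> Cmod s < 1 -> y <> 0 -> 0 < r < 1 ->
  exists K, zdom K r (fun n => zpow s (n * n) * zpow y n).
Proof.
move=> hs hs1 hy hr.
have key (z : C) : exists K, geom_dom K r (fun k => s ^ (k * k) * z ^ k).
  have h1 : is_lim_seq (fun n => Cmod z * Cmod s ^ n)%R 0.
    apply: is_lim_geom_scal; split => //; exact: Cmod_ge_0.
  move/is_lim_seq_spec in h1.
  have hp : (0 < r)%R by lra.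
  have [N hN] := h1 (mkposreal _ hp). rewrite /= in hN.
  apply: (geom_dom_eventually _ _ N); first lra.
  exists 1%R => k hk. rewrite Rmult_1_l.
  rewrite Cpow_mult_r -Cpow_mult_l Cmod_pow. apply: pow_incr.
  split; first exact: Cmod_ge_0.
  have := hN k hk. rewrite Rminus_0_r Rabs_pos_eq.
    rewrite Cmod_mult Cmod_pow Rmult_comm. lra.
  apply: Rmult_le_pos; first exact: Cmod_ge_0. apply: pow_le; exact: Cmod_ge_0.
have [K1 h1] := key y. have [K2 h2] := key (/ y).
exists (Rmax K1 K2) => n.
have hp : 0 <= r ^ Z.abs_nat n by apply: pow_le; lra.
case: (Z_le_gt_dec 0 n) => hn.
  have {1 2 3}-> : n = Z.of_nat (Z.abs_nat n) by lia.
  rewrite -Nat2Z.inj_mul !zpow_of_nat.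
  apply: Rle_trans; first exact: h1. apply: Rmult_le_compat_r => //; exact: Rmax_l.
have {1 2 3}-> : n = (- Z.of_nat (Z.abs_nat n))%Z by lia.
rewrite Z.mul_opp_opp -Nat2Z.inj_mul zpow_of_nat zpow_opp_of_nat -Cpow_inv //.
apply: Rle_trans; first exact: h2. apply: Rmult_le_compat_r => //; exact: Rmax_r.
Qed.

(** * The Jacobi triple product *)

Definition gterm (s y : C) (n : Z) : C := zpow s (n * n) * zpow y n.

Definition Gam (s y : C) : C := ZS (gterm s y).

Definition qfac (p : C) (n : nat) : C := pprod (fun k => 1 - p ^ S k) n.

(* 1/(p;p)_n, extended by zero to n < 0 so that [iqfac_pred] holds on all of Z. *)
Definition iqfac (p : C) (n : Z) : C := if (n <? 0)%Z then RtoC 0 else / qfac p (Z.to_nat n).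

Lemma Cpow_unit_neq1 (p : C) n : Cmod p < 1 -> 1 - p ^ S n <> 0.
Proof.
move=> hp e. have h : Cmod (p ^ S n) = 1%R.
  rewrite -Cmod_1. congr Cmod. replace (p ^ S n) with (1 - (1 - p ^ S n)) by ring. rewrite e. ring.
have := Cmod_ge_0 p. move: h. rewrite Cmod_pow => h h0.
have := pow_le_compat_exp (Cmod p) 1 (S n) ltac:(lra) ltac:(lia). rewrite h /=. lra.
Qed.

Lemma qfac_neq0 (p : C) n : Cmod p < 1 -> qfac p n <> 0.
Proof.
move=> hp. rewrite /qfac. elim: n => [|n IH]; first exact: C1_neq0.
apply: Cmult_neq_0 => //. exact: Cpow_unit_neq1.
Qed.

Lemma iqfac_pred (p : C) n : p <> 0 -> Cmod p < 1 -> iqfac p (n - 1) = (1 - zpow p n) * iqfac p n.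
Proof.
move=> hp0 hp. rewrite /iqfac.
case: (Z.ltb_spec n 0) => h1.
  have -> : (n - 1 <? 0)%Z = true by lia. ring.
case: (Z.ltb_spec (n - 1) 0) => h2.
  have -> : n = 0%Z by lia. rewrite /=. ring.
have e : Z.to_nat n = S (Z.to_nat (n - 1)) by lia.
have e' : zpow p n = p ^ S (Z.to_nat (n - 1)) by rewrite -zpow_of_nat; congr zpow; lia.
rewrite e e' /qfac pprod_S -/(qfac _ _).
field. split; [exact: Cpow_unit_neq1|exact: qfac_neq0].
Qed.

Lemma qfac_dom p : prod_dom (Cmod p) (Cmod p) (fun k => 1 - p ^ S k).
Proof.
move=> k. replace (1 - p ^ S k - 1) with (- p ^ S k) by ring.
rewrite Cmod_opp Cmod_pow /=. lra.
Qed.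

(* The coefficient of s^(j^2) y^j in the N-th partial product of the triple product, p = s^2:
   the Gaussian binomial [2N choose N+j], which vanishes for |j| > N. *)
Definition coef (p : C) (N : nat) (j : Z) : C :=
  qfac p (2 * N) * iqfac p (Z.of_nat N - j) * iqfac p (Z.of_nat N + j).

(** With p = s^2 this is multiplication of the N-th partial product by (1 + s^(2N+1) y)(1 + s^(2N+1)
    / y), read off at s^(j^2) y^j. Since p^(2N+2) = X Y, all four coefficients are rational
    functions of p, X, Y times [qfac p (2 * N) * a * b], and the recursion is a rational
    identity. *)
Lemma coef_rec (p : C) N j : p <> 0 -> Cmod p < 1 ->
  coef p (S N) j = (1 + p ^ (2 * N + 1)) * coef p N j
    + zpow p (Z.of_nat N + 1 - j) * coef p N (j - 1)
    + zpow p (Z.of_nat N + 1 + j) * coef p N (j + 1).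
Proof.
move=> hp0 hp. rewrite /coef.
set a := iqfac p (Z.of_nat (S N) - j). set b := iqfac p (Z.of_nat (S N) + j).
set X := zpow p (Z.of_nat N + 1 - j). set Y := zpow p (Z.of_nat N + 1 + j).
have sub1 m : zpow p (m - 1) = zpow p m / p.
  have -> : (m - 1 = m + -1)%Z by lia.
  rewrite zpow_add //. congr (_ * _). exact: (f_equal Cinv (Cmult_1_r p)).
have e1 : iqfac p (Z.of_nat N - j) = (1 - X) * a.
  rewrite /X /a.
  have -> : (Z.of_nat (S N) - j = Z.of_nat N + 1 - j)%Z by lia.
  rewrite -iqfac_pred //. congr iqfac. lia.
have e2 : iqfac p (Z.of_nat N + j) = (1 - Y) * b.
  rewrite /Y /b.
  have -> : (Z.of_nat (S N) + j = Z.of_nat N + 1 + j)%Z by lia.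
  rewrite -iqfac_pred //. congr iqfac. lia.
have e3 : iqfac p (Z.of_nat N - (j - 1)) = a by rewrite /a; congr iqfac; lia.
have e4 : iqfac p (Z.of_nat N + (j + 1)) = b by rewrite /b; congr iqfac; lia.
have e5 : iqfac p (Z.of_nat N + (j - 1)) = (1 - Y / p) * (1 - Y) * b.
  have -> : (Z.of_nat N + (j - 1) = Z.of_nat N + j - 1)%Z by lia.
  rewrite iqfac_pred // e2 /Y.
  have -> : (Z.of_nat N + j = Z.of_nat N + 1 + j - 1)%Z by lia.
  rewrite sub1. ring.
have e6 : iqfac p (Z.of_nat N - (j + 1)) = (1 - X / p) * (1 - X) * a.
  have -> : (Z.of_nat N - (j + 1) = Z.of_nat N - j - 1)%Z by lia.
  rewrite iqfac_pred // e1 /X.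
  have -> : (Z.of_nat N - j = Z.of_nat N + 1 - j - 1)%Z by lia.
  rewrite sub1. ring.
have eXY : p ^ S (S (2 * N)) = X * Y.
  rewrite /X /Y -zpow_add // -zpow_of_nat. congr zpow. lia.
have eXY' : p ^ S (2 * N) = X * Y / p.
  rewrite -eXY [p ^ S (S _)]Cpow_S. by field.
have -> : (2 * S N = S (S (2 * N)))%nat by lia.
have -> : (2 * N + 1 = S (2 * N))%nat by lia.
rewrite e1 e2 e3 e4 e5 e6 /qfac !pprod_S -/(qfac p (2 * N)).
rewrite eXY eXY'. by field.
Qed.

Lemma coef_0 p j : coef p 0 j = if (j =? 0)%Z then RtoC 1 else RtoC 0.
Proof.
rewrite /coef /iqfac. case: (Z.eqb_spec j 0) => [->|h].
  rewrite /qfac /=. field.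
case: (Z.ltb_spec (Z.of_nat 0 - j) 0) => h1; first by ring.
case: (Z.ltb_spec (Z.of_nat 0 + j) 0) => h2; first by ring.
lia.
Qed.

Lemma qfac_bound p : Cmod p < 1 -> exists B, forall n, Cmod (qfac p n) <= B.
Proof.
move=> hp. exists (exp (Cmod p / (1 - Cmod p))) => n.
apply: (pprod_bound (Cmod p) (Cmod p)); last exact: qfac_dom.
split => //; exact: Cmod_ge_0.
Qed.

Lemma iqfac_bound (p : C) : p <> 0 -> Cmod p < 1 -> exists B, forall n, Cmod (iqfac p n) <= B.
Proof.
move=> hp0 hp. have /Cmod_gt_0 h0 := hp0.
have [K hK] := prod_dom_inv _ _ _ (conj h0 hp) (qfac_dom p) (fun k => Cpow_unit_neq1 p k hp).
have hB n : Cmod (/ qfac p n) <= exp (K / (1 - Cmod p)).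
  rewrite -pprod_inv; last by move=> k; exact: Cpow_unit_neq1.
  apply: pprod_bound hK. lra.
exists (exp (K / (1 - Cmod p))) => n. rewrite /iqfac.
case: (n <? 0)%Z => //. rewrite Cmod_0. apply/Rlt_le/exp_pos.
Qed.

Definition qfac_inf (p : C) : C := Cprod (fun k => 1 - p ^ S k).

Lemma qfac_inf_neq0 (p : C) : p <> 0 -> Cmod p < 1 -> qfac_inf p <> 0.
Proof.
move=> /Cmod_gt_0 hp0 hp. apply: Cprod_neq0 (qfac_dom p) _ => // k. exact: Cpow_unit_neq1.
Qed.

Lemma qfac_lim (p : C) : Cmod p < 1 -> Clim (qfac p) (qfac_inf p).
Proof.
move=> hp. apply: (prod_dom_lim (Cmod p) (Cmod p)); last exact: qfac_dom.
split => //; exact: Cmod_ge_0.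
Qed.

Lemma iqfac_lim (p : C) (phi : nat -> Z) (c : nat) : p <> 0 -> Cmod p < 1 ->
  (forall n, Z.of_nat n - Z.of_nat c <= phi n)%Z ->
  Clim (fun n => iqfac p (phi n)) (/ qfac_inf p).
Proof.
move=> hp0 hp hphi. have /Cmod_gt_0 h0 := hp0.
have hn k : 1 - p ^ S k <> 0 by exact: Cpow_unit_neq1.
have [K hK] := prod_dom_inv _ _ _ (conj h0 hp) (qfac_dom p) hn.
have e : / qfac_inf p = Cprod (fun k => / (1 - p ^ S k)).
  have := Cprod_inv_mult _ _ _ (conj h0 hp) (qfac_dom p) hn. exact: Cinv_unique.
have H : Clim (fun n => / qfac p n) (/ qfac_inf p).
  rewrite e. apply: (Clim_ext (pprod (fun k => / (1 - p ^ S k)))).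
    by move=> n; rewrite pprod_inv.
  apply: prod_dom_lim hK. lra.
have H2 : Clim (fun n => / qfac p (Z.to_nat (phi n))) (/ qfac_inf p).
  apply: (Clim_subseq (fun n => / qfac p n)) H.
  move=> P [N hN]; exists (N + c)%nat => n hn'. apply: hN. have := hphi n. lia.
(* From n = c on [phi n] is nonnegative, so the default value 0 of [iqfac] is not reached. *)
apply: (is_lim_seq_ext_loc _ _ _ _ H2). exists c => n hn'. rewrite /iqfac.
by have -> : (phi n <? 0)%Z = false by have := hphi n; lia.
Qed.

Lemma coef_lim (p : C) j : p <> 0 -> Cmod p < 1 -> Clim (fun N => coef p N j) (/ qfac_inf p).
Proof.
move=> hp0 hp. have hq := qfac_inf_neq0 _ hp0 hp.
replace (/ qfac_inf p) with (qfac_inf p * / qfac_inf p * / qfac_inf p) by (field; done).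
apply: Clim_mult; first apply: Clim_mult.
- apply: (Clim_subseq (qfac p)); last exact: qfac_lim. by apply: filterlim_ge_id => n; lia.
- apply: (iqfac_lim _ _ (Z.abs_nat j)) => // n. lia.
- apply: (iqfac_lim _ _ (Z.abs_nat j)) => // n. lia.
Qed.

(** Uniformity in both N and j is what the passage to the limit in the triple product requires. *)
Lemma coef_bound (p : C) : p <> 0 -> Cmod p < 1 -> exists B, forall N j, Cmod (coef p N j) <= B.
Proof.
move=> hp0 hp. have [A hA] := qfac_bound _ hp. have [B hB] := iqfac_bound _ hp0 hp.
exists (A * B * B)%R => N j. rewrite /coef !Cmod_mult.
apply: Rmult_le_compat => //; try exact: Cmod_ge_0.
  apply: Rmult_le_pos; exact: Cmod_ge_0.
apply: Rmult_le_compat => //; exact: Cmod_ge_0.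
Qed.

Lemma gterm_succ (s y : C) n : s <> 0 -> y <> 0 ->
  gterm s y (n + 1) = zpow s (2 * n) * s * y * gterm s y n.
Proof.
move=> hs hy. rewrite /gterm.
have -> : ((n + 1) * (n + 1) = n * n + 2 * n + 1)%Z by lia.
rewrite !zpow_add // !zpow_1_r. ring.
Qed.

Lemma gterm_dom (s y : C) r : s <> 0 -> Cmod s < 1 -> y <> 0 -> 0 < r < 1 ->
  exists K, zdom K r (gterm s y).
Proof. exact: gauss_dom. Qed.

(** Induction by [coef_rec], with the terms in j - 1 and j + 1 shifted back to j. The finite sum is
    written as a series over Z so that dominated convergence applies to it directly. *)
Lemma finite_jtp (s y : C) N : s <> 0 -> Cmod s < 1 -> y <> 0 ->
  pprod (fun k => (1 + s ^ (2 * k + 1) * y) * (1 + s ^ (2 * k + 1) / y)) N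
  = ZS (fun j => coef (s * s) N j * gterm s y j).
Proof.
move=> hs hs1 hy.
have hp0 : s * s <> 0 by exact: Cmult_neq_0.
have hp : Cmod (s * s) < 1 by rewrite Cmod_mult; have := Cmod_ge_0 s; nra.
have hr : 0 < /2 < 1 by lra. have hr' : 0 <= /2 < 1 by lra.
have [K hK] := gterm_dom s y (/2) hs hs1 hy hr.
have [B hB] := coef_bound _ hp0 hp.
have hd M : zdom (B * K) (/2) (fun j => coef (s * s) M j * gterm s y j).
  move=> j. rewrite Cmod_mult Rmult_assoc.
  apply: Rmult_le_compat => //; try exact: Cmod_ge_0.
elim: N => [|N IH].
  rewrite [LHS]/=. symmetry.
  rewrite /ZS. apply: (CS_is (2 * (B * K)) (/2)) => //.
    apply: fz_dom => //; lra.
  have e : csum (fz (fun j => coef (s * s) 0 j * gterm s y j)) 1 = 1.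
    by rewrite /= /fz !coef_0 /= /gterm /=; ring.
  have H : Clim (csum (fz (fun j => coef (s * s) 0 j * gterm s y j)))
      (csum (fz (fun j => coef (s * s) 0 j * gterm s y j)) 1); last by rewrite e in H.
  apply: CS_finite => k hk. rewrite /fz !coef_0.
  have -> : (Z.of_nat k =? 0)%Z = false by lia.
  have -> : (- Z.of_nat k - 1 =? 0)%Z = false by lia. ring.
have sn : zpow s (2 * Z.of_nat N + 1) = s ^ (2 * N + 1) by rewrite -zpow_of_nat; congr zpow; lia.
have e1 j : zpow (s * s) (Z.of_nat N + 1 - j) * coef (s * s) N (j - 1) * gterm s y j
   = s ^ (2 * N + 1) * y * (coef (s * s) N (j + -1) * gterm s y (j + -1)).
  have ej : gterm s y j = zpow s (2 * (j + -1)) * s * y * gterm s y (j + -1).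
    rewrite -gterm_succ //. congr gterm. lia.
  rewrite ej -zpow_2 -zpow_mul_r // -sn.
  have -> : (2 * Z.of_nat N + 1 = 2 * (Z.of_nat N + 1 - j) + 2 * (j + -1) + 1)%Z by lia.
  rewrite !(zpow_add s) // zpow_1_r. have -> : (j - 1 = j + -1)%Z by lia. ring.
have e2 j : zpow (s * s) (Z.of_nat N + 1 + j) * coef (s * s) N (j + 1) * gterm s y j
   = s ^ (2 * N + 1) / y * (coef (s * s) N (j + 1) * gterm s y (j + 1)).
  rewrite gterm_succ // -zpow_2 -zpow_mul_r // -sn.
  have -> : (2 * (Z.of_nat N + 1 + j) = (2 * Z.of_nat N + 1) + (2 * j + 1))%Z by lia.
  rewrite !(zpow_add s) // zpow_1_r. by field.
have hd' a : zdom (B * K / (/2) ^ Z.abs_nat a) (/2) (fun j => coef (s * s) N (j + a) * gterm s y (j + a)).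
  apply: (zdom_shift _ _ (fun j => coef (s * s) N j * gterm s y j)) => //. lra.
have hK0 : 0 <= B * K by exact: (zdom_ge0 _ _ _ (hd 0%nat)).
set c0 := 1 + (s * s) ^ (2 * N + 1). set c1 := s ^ (2 * N + 1) * y. set c2 := s ^ (2 * N + 1) / y.
rewrite (ZS_ext _ (fun j => c0 * (coef (s * s) N j * gterm s y j)
   + (c1 * (coef (s * s) N (j + -1) * gterm s y (j + -1))
   + c2 * (coef (s * s) N (j + 1) * gterm s y (j + 1))))); last first.
  move=> j. rewrite coef_rec // -e1 -e2 /c0. ring.
set K0 := (Rmax (Cmod c0 * (B * K)) (Rmax (Cmod c1 * (B * K / (/2) ^ 1)) (Cmod c2 * (B * K / (/2) ^ 1))))%R.
have m1 := Rmax_l (Cmod c0 * (B * K)) (Rmax (Cmod c1 * (B * K / (/2) ^ 1)) (Cmod c2 * (B * K / (/2) ^ 1))).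
have m2 := Rmax_r (Cmod c0 * (B * K)) (Rmax (Cmod c1 * (B * K / (/2) ^ 1)) (Cmod c2 * (B * K / (/2) ^ 1))).
have m3 := Rmax_l (Cmod c1 * (B * K / (/2) ^ 1)) (Cmod c2 * (B * K / (/2) ^ 1)).
have m4 := Rmax_r (Cmod c1 * (B * K / (/2) ^ 1)) (Cmod c2 * (B * K / (/2) ^ 1)).
rewrite -/K0 in m1 m2.
have d0 : zdom K0 (/2) (fun j => c0 * (coef (s * s) N j * gterm s y j)).
  apply: zdom_le (zdom_scal _ _ c0 _ (hd N)); lra.
have d1 : zdom K0 (/2) (fun j => c1 * (coef (s * s) N (j + -1) * gterm s y (j + -1))).
  apply: zdom_le (zdom_scal _ _ c1 _ (hd' (-1)%Z)); [lra|apply: Rle_trans m2; exact: m3].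
have d2 : zdom K0 (/2) (fun j => c2 * (coef (s * s) N (j + 1) * gterm s y (j + 1))).
  apply: zdom_le (zdom_scal _ _ c2 _ (hd' 1%Z)); [lra|apply: Rle_trans m2; exact: m4].
have hK1 : 0 <= K0 := zdom_ge0 _ _ _ d0.
rewrite (ZS_plus (K0 + K0) (/2)) //; last first.
- move=> j. apply: Rle_trans; first exact: Cmod_triangle. have := d1 j; have := d2 j; lra.
- apply: zdom_le d0; lra.
rewrite (ZS_plus K0 (/2)) // (ZS_scal (B * K) (/2) c0) // (ZS_scal _ (/2) c1 _ hr' (hd' (-1)%Z))
  (ZS_scal _ (/2) c2 _ hr' (hd' 1%Z)).
rewrite (ZS_shift _ _ (fun j => coef (s * s) N j * gterm s y j) _ hr (hd N)).
rewrite (ZS_shift _ _ (fun j => coef (s * s) N j * gterm s y j) _ hr (hd N)).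
rewrite -IH pprod_S /c0 /c1 /c2 Cpow_mult_l. by field.
Qed.

Definition odd_factor (s y : C) (k : nat) : C :=
  (1 + s ^ (2 * k + 1) * y) * (1 + s ^ (2 * k + 1) / y).

Lemma geom_dom_prod (K L r : R) (f g : nat -> C) : 0 <= r <= 1 -> prod_dom K r f -> prod_dom L r g ->
  prod_dom (K + L + K * L) r (fun k => f k * g k).
Proof.
move=> hr hf hg k.
replace (f k * g k - 1) with ((f k - 1) + (g k - 1) + (f k - 1) * (g k - 1)) by ring.
have h1 := hf k. have h2 := hg k. have hK := geom_dom_ge0 _ _ _ hf. have hL := geom_dom_ge0 _ _ _ hg.
have t1 := Cmod_triangle (f k - 1 + (g k - 1)) ((f k - 1) * (g k - 1)).
have t2 := Cmod_triangle (f k - 1) (g k - 1).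
rewrite Cmod_mult in t1.
have hp : 0 <= r ^ k by apply: pow_le; lra.
have hp1 : r ^ k <= 1 by apply: (pow_le_compat_exp r 0 k); [lra|lia].
have h3 : Cmod (f k - 1) * Cmod (g k - 1) <= K * r ^ k * (L * r ^ k).
  apply: Rmult_le_compat => //; exact: Cmod_ge_0.
have h4 : K * r ^ k * (L * r ^ k) <= K * L * r ^ k.
  have hKL := Rmult_le_pos _ _ hK hL. have h5 := Rmult_le_pos _ _ hKL hp. nra.
lra.
Qed.

Lemma prod_dom_pow (p a : C) : Cmod p <= 1 -> prod_dom (Cmod a) (Cmod p) (fun k => 1 + a * p ^ k).
Proof.
move=> hp k. replace (1 + a * p ^ k - 1) with (a * p ^ k) by ring.
rewrite Cmod_mult Cmod_pow. lra.
Qed.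

Lemma odd_factor_dom (s y : C) : Cmod s < 1 -> exists K, prod_dom K (Cmod (s * s)) (odd_factor s y).
Proof.
move=> hs. have h0 := Cmod_ge_0 s.
have hp : Cmod (s * s) <= 1 by rewrite Cmod_mult; nra.
exists (Cmod (s * y) + Cmod (s / y) + Cmod (s * y) * Cmod (s / y))%R.
have hd : prod_dom (Cmod (s * y) + Cmod (s / y) + Cmod (s * y) * Cmod (s / y)) (Cmod (s * s))
   (fun k => (1 + (s * y) * (s * s) ^ k) * (1 + (s / y) * (s * s) ^ k)).
  apply: geom_dom_prod; [|exact: prod_dom_pow..]. split => //; exact: Cmod_ge_0.
move=> k. move: (hd k) => /=. rewrite /odd_factor Cpow_add_r Cpow_mult_r [s ^ 2]/= !Cmult_1_r [s ^ 1]/= !Cmult_1_r.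
congr (_ <= _)%R. congr Cmod. rewrite /Cdiv. ring.
Qed.

(** Limit of [finite_jtp]: each Gaussian binomial tends to 1/(p;p)_infinity with p = s^2, under a
    majorant independent of N. *)
Lemma jacobi_triple_product (s y : C) : s <> 0 -> Cmod s < 1 -> y <> 0 ->
  Gam s y = qfac_inf (s * s) * Cprod (odd_factor s y).
Proof.
move=> hs hs1 hy.
have hp0 : s * s <> 0 by exact: Cmult_neq_0.
have hp : Cmod (s * s) < 1 by rewrite Cmod_mult; have := Cmod_ge_0 s; nra.
have hr : 0 < /2 < 1 by lra. have hr' : 0 <= /2 < 1 by lra.
have [K hK] := gterm_dom s y (/2) hs hs1 hy hr.
have [B hB] := coef_bound _ hp0 hp.
have H : Clim (fun N => ZS (fun j => coef (s * s) N j * gterm s y j))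
    (ZS (fun j => / qfac_inf (s * s) * gterm s y j)).
  apply: (ZS_tannery (B * K) (/2)) => // [M j|j].
    rewrite Cmod_mult Rmult_assoc. apply: Rmult_le_compat => //; exact: Cmod_ge_0.
  apply: Clim_mult; [exact: coef_lim|exact: Clim_const].
rewrite (ZS_scal K (/2)) // in H.
have [K' hK'] := odd_factor_dom s y hs1.
have H2 : Clim (pprod (odd_factor s y)) (Cprod (odd_factor s y)).
  apply: prod_dom_lim hK'. split => //; exact: Cmod_ge_0.
have e : Cprod (odd_factor s y) = / qfac_inf (s * s) * Gam s y.
  apply: Clim_unique H2 _. apply: Clim_ext H => N. by rewrite -finite_jtp.
rewrite e. field. exact: qfac_inf_neq0.
Qed.

Lemma Gam_quasi_period (s y : C) : s <> 0 -> Cmod s < 1 -> y <> 0 ->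
  Gam s (s * s * y) * (s * y) = Gam s y.
Proof.
move=> hs hs1 hy. have hr : 0 < /2 < 1 by lra. have hr' : 0 <= /2 < 1 by lra.
have [K hK] := gterm_dom s y (/2) hs hs1 hy hr.
have hy' : s * s * y <> 0 by repeat apply: Cmult_neq_0.
have [L hL] := gterm_dom s _ (/2) hs hs1 hy' hr.
rewrite /Gam -(ZS_shift K (/2) (gterm s y) 1) // Cmult_comm -(ZS_scal L (/2)) //.
apply: ZS_ext => n. rewrite gterm_succ // /gterm zpow_mul_l //; last exact: Cmult_neq_0.
rewrite -zpow_2 -zpow_mul_r //. ring.
Qed.

(** Sum over index pairs (n + m, n) and split by the parity of m. For m = 2l, n = k - l the
    exponents give (k+l)^2 + (k-l)^2 = 2k^2 + 2l^2, which separates k from l. For m = 2l+1 there is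
    an excess 2k + 2l + 1: its parts 2k and 2l produce the factors s^2 in the arguments, and the 1
    produces the s in front. *)
Lemma Gam_mul (s a b : C) : s <> 0 -> Cmod s < 1 -> a <> 0 -> b <> 0 ->
  Gam s a * Gam s b = Gam (s * s) (a * b) * Gam (s * s) (a / b)
    + s * a * (Gam (s * s) (s * s * (a * b)) * Gam (s * s) (s * s * (a / b))).
Proof.
move=> hs hs1 ha hb. have h0 := Cmod_ge_0 s.
have hss : s * s <> 0 by exact: Cmult_neq_0.
have hss1 : Cmod (s * s) < 1 by rewrite Cmod_mult; nra.
have hab : a * b <> 0 by exact: Cmult_neq_0.
have hadb : a / b <> 0 by exact: Cdiv_neq0.
have hr : 0 < /2 < 1 by lra. have hr' : 0 <= /2 < 1 by lra.
(* Rate 1/4 in the indices n + m and n yields rate 1/2 in m and n, because 2|n+m| + 2|n| >= |m| +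
   |n|. *)
have hq : 0 < /4 < 1 by lra. have hq' : 0 <= /4 < 1 by lra.
have [K hK] := gterm_dom s a (/4) hs hs1 ha hq.
have [L hL] := gterm_dom s b (/4) hs hs1 hb hq.
have hK0 := zdom_ge0 _ _ _ hK. have hL0 := zdom_ge0 _ _ _ hL.
have hF m n : Cmod (gterm s a (n + m) * gterm s b n) <= K * L * (/2) ^ Z.abs_nat m * (/2) ^ Z.abs_nat n.
  rewrite Cmod_mult.
  apply: (Rle_trans _ (K * (/4) ^ Z.abs_nat (n + m) * (L * (/4) ^ Z.abs_nat n))).
    apply: Rmult_le_compat => //; exact: Cmod_ge_0.
  have -> : (/ 4 = (/2) ^ 2)%R by field.
  rewrite -!pow_mult.
  have -> : (K * (/ 2) ^ (2 * Z.abs_nat (n + m)) * (L * (/ 2) ^ (2 * Z.abs_nat n))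
     = K * L * ((/2) ^ (2 * Z.abs_nat (n + m) + 2 * Z.abs_nat n)))%R by rewrite pow_add; ring.
  have -> : (K * L * (/ 2) ^ Z.abs_nat m * (/ 2) ^ Z.abs_nat n
     = K * L * ((/2) ^ (Z.abs_nat m + Z.abs_nat n)))%R by rewrite pow_add; ring.
  apply: Rmult_le_compat_l; first exact: Rmult_le_pos.
  apply: pow_le_compat_exp; [lra|lia].
have hrow m : zdom (K * L * (/2) ^ Z.abs_nat m) (/2) (fun n => gterm s a (n + m) * gterm s b n).
  by move=> n; exact: hF.
have step1 : Gam s a * Gam s b = ZS (fun m => ZS (fun n => gterm s a (n + m) * gterm s b n)).
  rewrite (ZS_fubini (K * L) (/2)) // /Gam -(ZS_scal L (/4)) //.
  apply: ZS_ext => n. rewrite Cmult_comm -(ZS_shift K (/4) (gterm s a) n) //.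
  rewrite -(ZS_scal (K / (/4) ^ Z.abs_nat n) (/4)) //; last by apply: zdom_shift => //; lra.
  apply: ZS_ext => m. by rewrite Z.add_comm Cmult_comm.
rewrite step1.
have hs2 : zdom (2 * (K * L) / (1 - /2)) (/2) (fun m => ZS (fun n => gterm s a (n + m) * gterm s b n)).
  move=> m. apply: Rle_trans; first exact: ZS_bound hr' (hrow m).
  right; field; lra.
rewrite (ZS_even_odd _ _ _ hr hs2).
have hG (z : C) : z <> 0 -> exists M, zdom M (/2) (gterm (s * s) z).
  by move=> hz; exact: gterm_dom.
have hfac (c z w : C) (F : Z -> Z -> C) : z <> 0 -> w <> 0 ->
   (forall l k, F l k = c * (gterm (s * s) z k * gterm (s * s) w l)) ->
   ZS (fun l => ZS (F l)) = c * (Gam (s * s) z * Gam (s * s) w).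
  move=> hz hw hF'. have [M hM] := hG z hz. have [M' hM'] := hG w hw.
  rewrite (ZS_ext _ (fun l => (c * Gam (s * s) z) * gterm (s * s) w l)).
    rewrite (ZS_scal M' (/2)) // -/(Gam _ _). ring.
  move=> l. rewrite (ZS_ext _ (fun k => (c * gterm (s * s) w l) * gterm (s * s) z k)).
    rewrite (ZS_scal M (/2)) // -/(Gam _ _). ring.
  move=> k. rewrite hF'. ring.
congr (_ + _).
  rewrite -[RHS]Cmult_1_l -(hfac _ _ _ (fun l k => gterm s a (k + l) * gterm s b (k - l))) //.
    apply: ZS_ext => l. rewrite -(ZS_shift _ _ _ (- l) hr (hrow (2 * l)%Z)).
    apply: ZS_ext => k. congr (gterm _ _ _ * gterm _ _ _); lia.
  move=> l k. rewrite /gterm /Cdiv !zpow_mul_l //; try by nz.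
  rewrite zpow_inv //.
  have -> : ((k + l) * (k + l) = k * k + l * l + 2 * (k * l))%Z by lia.
  have -> : ((k - l) * (k - l) = k * k + l * l + - (2 * (k * l)))%Z by lia.
  rewrite -Z.add_opp_r !zpow_add // !zpow_opp //. field.
  by split; exact: zpow_neq0.
rewrite -(hfac _ _ _ (fun l k => gterm s a (k + l + 1) * gterm s b (k - l))); last first.
- move=> l k. rewrite /gterm /Cdiv !zpow_mul_l //; try by nz; try exact: zpow_neq0.
  rewrite zpow_inv //.
  have -> : ((k + l + 1) * (k + l + 1) = k * k + l * l + 2 * (k * l) + k + k + l + l + 1)%Z by lia.
  have -> : ((k - l) * (k - l) = k * k + l * l + - (2 * (k * l)))%Z by lia.
  rewrite -Z.add_opp_r !zpow_add // !zpow_opp // !zpow_1_r. field.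
  by split; exact: zpow_neq0.
- exact: Cmult_neq_0.
- exact: Cmult_neq_0.
apply: ZS_ext => l. rewrite -(ZS_shift _ _ _ (- l) hr (hrow (2 * l + 1)%Z)).
apply: ZS_ext => k. congr (gterm _ _ _ * gterm _ _ _); lia.
Qed.

(** * Theta functions and the three-term relation *)

(** In terms of p = s^2 this is the sum of (-1)^n p^(n(n-1)/2) z^n. The parameter is a square root
    of the period p because the half periods s and -s are needed as points. *)
Definition theta (s z : C) : C := Gam s (- z / s).

Definition theta_factor (p z : C) (k : nat) : C := (1 - p ^ k * z) * (1 - p ^ S k / z).

Definition theta_prod (p z : C) : C := Cprod (theta_factor p z).

Lemma theta_factor_odd (s z : C) k : s <> 0 -> z <> 0 ->
  odd_factor s (- z / s) k = theta_factor (s * s) z k.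
Proof.
move=> hs hz. rewrite /odd_factor /theta_factor Cpow_S Cpow_add_r Cpow_mult_r.
rewrite [s ^ 2]/= [s ^ 1]/= !Cmult_1_r. field. by split.
Qed.

Lemma theta_product (s z : C) : s <> 0 -> Cmod s < 1 -> z <> 0 ->
  theta s z = qfac_inf (s * s) * theta_prod (s * s) z.
Proof.
move=> hs hs1 hz. rewrite /theta jacobi_triple_product //; last by nz.
congr (_ * _). apply: Cprod_ext => k. exact: theta_factor_odd.
Qed.

Lemma prod_dom_pow_sub (p a : C) : Cmod p <= 1 -> prod_dom (Cmod a) (Cmod p) (fun k => 1 - p ^ k * a).
Proof.
move=> hp k. replace (1 - p ^ k * a - 1) with (- (a * p ^ k)) by ring.
rewrite Cmod_opp Cmod_mult Cmod_pow. lra.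
Qed.

Lemma prod_dom_ext K r f g : (forall k, f k = g k) -> prod_dom K r f -> prod_dom K r g.
Proof. move=> h hf k. rewrite -h. exact: hf. Qed.

Lemma theta_factor_dom (p z : C) : Cmod p < 1 -> exists K, prod_dom K (Cmod p) (theta_factor p z).
Proof.
move=> hp. have h0 := Cmod_ge_0 p.
exists (Cmod z + Cmod (p / z) + Cmod z * Cmod (p / z))%R.
apply: (prod_dom_ext _ _ (fun k => (1 - p ^ k * z) * (1 - p ^ k * (p / z)))).
  move=> k. rewrite /theta_factor Cpow_S /Cdiv. ring.
apply: geom_dom_prod; [lra|apply: prod_dom_pow_sub; lra..].
Qed.

Lemma one_sub_neq0 (x : C) : Cmod x < 1 -> 1 - x <> 0.
Proof.
move=> h e. have : Cmod x = 1%R; last lra.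
rewrite -Cmod_1. congr Cmod. replace x with (1 - (1 - x)) by ring. rewrite e. ring.
Qed.

(** The factors vanish only at powers of p, and z = 1 is the only one of these in the annulus. *)
Lemma theta_prod_neq0 (p z : C) : p <> 0 -> Cmod p < Cmod z -> Cmod z <= 1 -> z <> 1 ->
  theta_prod p z <> 0.
Proof.
move=> hp0 h1 h2 hz1. have /Cmod_gt_0 h0 := hp0.
have hz : z <> 0 by apply/Cmod_gt_0; lra.
have hp1 : Cmod p < 1 by lra.
have [K hK] := theta_factor_dom p z hp1.
apply: Cprod_neq0 hK _ => // k. apply: Cmult_neq_0.
  case: k => [|k].
    rewrite /= Cmult_1_l => e. apply: hz1. replace z with (1 - (1 - z)) by ring. rewrite e. ring.
  apply: one_sub_neq0. rewrite Cmod_mult Cmod_pow.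
  have := pow_le_compat_exp (Cmod p) 1 (S k) ltac:(lra) ltac:(lia). rewrite [(_ ^ 1)%R]/= Rmult_1_r.
  have := pow_lt (Cmod p) (S k) h0. nra.
apply: one_sub_neq0. rewrite Cmod_div // Cmod_pow.
have := pow_le_compat_exp (Cmod p) 1 (S k) ltac:(lra) ltac:(lia). rewrite [(_ ^ 1)%R]/= Rmult_1_r => h3.
apply: (Rmult_lt_reg_r (Cmod z)); first lra. rewrite /Rdiv Rmult_assoc Rinv_l; lra.
Qed.

Lemma Cmod_sqr_lt1 (s : C) : Cmod s < 1 -> Cmod (s * s) < 1.
Proof. move=> h. rewrite Cmod_mult. have := Cmod_ge_0 s. nra. Qed.

Lemma theta_neq0 (s z : C) : s <> 0 -> Cmod s < 1 -> Cmod (s * s) < Cmod z -> Cmod z <= 1 -> z <> 1 ->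
  theta s z <> 0.
Proof.
move=> hs hs1 h1 h2 hz1. have hz : z <> 0 by apply/Cmod_gt_0; have := Cmod_ge_0 (s * s); lra.
have hss : s * s <> 0 by nz. have hss1 := Cmod_sqr_lt1 s hs1.
rewrite theta_product //. apply: Cmult_neq_0; [exact: qfac_inf_neq0|exact: theta_prod_neq0].
Qed.

Lemma theta_quasi_period (s z : C) : s <> 0 -> Cmod s < 1 -> z <> 0 ->
  theta s (s * s * z) * z = - theta s z.
Proof.
move=> hs hs1 hz. rewrite /theta -(Gam_quasi_period s (- z / s)) //; last by nz.
have -> : s * s * (- z / s) = - (s * s * z) / s by field.
field. done.
Qed.

Lemma theta_reflect (s z : C) : s <> 0 -> Cmod s < 1 -> z <> 0 -> theta s (s * s / z) = theta s z.
Proof.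
move=> hs hs1 hz. rewrite !theta_product //; try by nz.
congr (_ * _). apply: Cprod_ext => k. rewrite /theta_factor Cpow_S. field. by split.
Qed.

(** The k-th factors for z and -z combine to the factor of index 2k for z^2, those for sz and -sz to
    the factor of index 2k+1. *)
Lemma theta_prod_duplication (s z : C) : s <> 0 -> Cmod s < 1 -> z <> 0 ->
  let p := s * s in
  theta_prod p z * theta_prod p (- z) * (theta_prod p (s * z) * theta_prod p (- (s * z)))
  = theta_prod p (z * z).
Proof.
move=> hs hs1 hz p. have hp := Cmod_sqr_lt1 s hs1. rewrite -/p in hp.
have hr : 0 <= Cmod p < 1 by split => //; exact: Cmod_ge_0.
have hr' : 0 <= Cmod p <= 1 by lra.
have [K0 h0] := theta_factor_dom p z hp. have [K1 h1] := theta_factor_dom p (- z) hp.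
have [K2 h2] := theta_factor_dom p (s * z) hp. have [K3 h3] := theta_factor_dom p (- (s * z)) hp.
have [K4 h4] := theta_factor_dom p (z * z) hp.
rewrite /theta_prod -(Cprod_group _ _ 2 _ _ hr h4); last lia.
rewrite -(Cprod_mult _ _ _ _ _ hr h0 h1) -(Cprod_mult _ _ _ _ _ hr h2 h3).
rewrite -(Cprod_mult _ _ _ _ _ hr (geom_dom_prod _ _ _ _ _ hr' h0 h1) (geom_dom_prod _ _ _ _ _ hr' h2 h3)).
apply: Cprod_ext => k. rewrite /= /theta_factor.
have -> : (k + (k + 0) + 0 = k + k)%nat by lia.
have -> : (k + (k + 0) + 1 = S (k + k))%nat by lia.
rewrite !Cpow_S !Cpow_add_r /p. field. by split.
Qed.

(** With R the product of 1 + p^n (n >= 1) and U that of 1 - p^n (n odd), the value at -1 is 2 R^2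
    and the values at s and -s multiply to U^2. Euler's identity R U = 1 follows by writing the
    product over even n both as P / U and as P R. *)
Lemma theta_prod_half_periods (s : C) : s <> 0 -> Cmod s < 1 ->
  let p := s * s in
  theta_prod p (-(1)) * (theta_prod p s * theta_prod p (- s)) = 2.
Proof.
move=> hs hs1 p. have hp := Cmod_sqr_lt1 s hs1. rewrite -/p in hp.
have hp0 : p <> 0 by rewrite /p; nz.
have hr : 0 <= Cmod p < 1 by split => //; exact: Cmod_ge_0.
have hr' : 0 <= Cmod p <= 1 by lra. have hp' : Cmod p <= 1 by lra.
set R := Cprod (fun k => 1 + p ^ S k).
set U := Cprod (fun k => 1 - (p * p) ^ k * p).
set P := qfac_inf p.
have hpp : Cmod (p * p) < 1 by exact: Cmod_sqr_lt1.
have hrr : 0 <= Cmod (p * p) < 1 by split => //; exact: Cmod_ge_0.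
have dP := qfac_dom p. rewrite -/p in dP.
have dR0 : prod_dom (Cmod (-(1))) (Cmod p) (fun k => 1 - p ^ k * (-(1))) by exact: prod_dom_pow_sub.
have dR : prod_dom (Cmod (- p)) (Cmod p) (fun k => 1 + p ^ S k).
  apply: (prod_dom_ext _ _ (fun k => 1 - p ^ k * (- p))); last exact: prod_dom_pow_sub.
  move=> k. rewrite Cpow_S. ring.
have dU : prod_dom (Cmod p) (Cmod (p * p)) (fun k => 1 - (p * p) ^ k * p) by apply: prod_dom_pow_sub; lra.
have dV : prod_dom (Cmod (p * p)) (Cmod (p * p)) (fun k => 1 - (p * p) ^ k * (p * p)) by apply: prod_dom_pow_sub; lra.
have eRU : R * U = 1.
  have e1 : P = U * Cprod (fun k => 1 - (p * p) ^ k * (p * p)).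
    rewrite /P /qfac_inf -(Cprod_group _ _ 2 _ _ hr dP); last lia.
    rewrite /U -(Cprod_mult _ _ _ _ _ hrr dU dV). apply: Cprod_ext => k. rewrite /=.
    have -> : (k + (k + 0) + 0 = k + k)%nat by lia.
    have -> : (k + (k + 0) + 1 = S (k + k))%nat by lia.
    rewrite !Cpow_S !Cpow_add_r Cpow_mult_l. ring.
  have e2 : Cprod (fun k => 1 - (p * p) ^ k * (p * p)) = P * R.
    rewrite /P /R -(Cprod_mult _ _ _ _ _ hr dP dR). apply: Cprod_ext => k.
    rewrite !Cpow_S !Cpow_mult_l. ring.
  have hP : P <> 0 by exact: qfac_inf_neq0.
  rewrite e2 in e1. have e3 : P * (R * U) / P = R * U by field.
  rewrite -e3. replace (P * (R * U)) with (U * (P * R)) by ring. rewrite -e1. by field.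
have eR0 : theta_prod p (-(1)) = 2 * R * R.
  rewrite /theta_prod (Cprod_ext _ (fun k => (1 - p ^ k * (-(1))) * (1 + p ^ S k))).
    rewrite (Cprod_mult _ _ _ _ _ hr dR0 dR) (Cprod_S _ _ _ hr dR0) /=.
    rewrite (Cprod_ext (fun k => 1 - p * p ^ k * - (1)) (fun k => 1 + p ^ S k)); last by move=> k /=; ring.
    rewrite -/R. ring.
  move=> k. rewrite /theta_factor. field.
have [K0 d0] := theta_factor_dom p s hp. have [K1 d1] := theta_factor_dom p (- s) hp.
have eU : theta_prod p s * theta_prod p (- s) = U * U.
  rewrite /theta_prod -(Cprod_mult _ _ _ _ _ hr d0 d1) /U -(Cprod_mult _ _ _ _ _ hrr dU dU).
  apply: Cprod_ext => k. rewrite /theta_factor /p !Cpow_S !Cpow_mult_l. field. done.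
rewrite eR0 eU. replace (2 * R * R * (U * U)) with (2 * (R * U) * (R * U)) by ring. rewrite eRU. ring.
Qed.

(** Dividing by x makes the expression antisymmetric in x and y. *)
Definition bracket (s x y : C) : C := theta s (x * y) * theta s (x / y) / x.

(* Splitting the double series of theta(xy) theta(x/y) by parity makes it a 2x2 determinant. *)
Lemma bracket_det (s : C) : s <> 0 -> Cmod s < 1 -> exists G O : C -> C,
  forall x y : C, x <> 0 -> y <> 0 -> bracket s x y = G x * O y - O x * G y.
Proof.
move=> hs hs1. have hss : s * s <> 0 by nz. have hss1 := Cmod_sqr_lt1 s hs1.
exists (fun x => Gam (s * s) (x * x / (s * s)) / x), (fun x => Gam (s * s) (x * x)).
move=> x y hx hy. rewrite /bracket /theta.
have hxy : - (x * y) / s <> 0 by nz.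
have hx_y : - (x / y) / s <> 0 by nz.
rewrite Gam_mul //.
have -> : - (x * y) / s * (- (x / y) / s) = x * x / (s * s) by field; split.
have -> : - (x * y) / s / (- (x / y) / s) = y * y by field; repeat split.
have -> : s * s * (x * x / (s * s)) = x * x by field.
have e := Gam_quasi_period (s * s) (y * y / (s * s)) hss hss1 ltac:(by nz).
have e2 : Gam (s * s) (y * y / (s * s)) = Gam (s * s) (s * s * (y * y)) * (y * y).
  rewrite -e. have -> : s * s * (s * s) * (y * y / (s * s)) = s * s * (y * y) by field.
  by field.
rewrite e2. field. by repeat split.
Qed.

Lemma bracket_pluecker (s x y z w : C) : s <> 0 -> Cmod s < 1 ->
  x <> 0 -> y <> 0 -> z <> 0 -> w <> 0 ->
  bracket s x y * bracket s z w - bracket s x z * bracket s y w + bracket s x w * bracket s y z = 0.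
Proof.
move=> hs hs1 hx hy hz hw. have [G [O h]] := bracket_det s hs hs1. rewrite !h //. ring.
Qed.

(** * The Weierstrass cubic *)

(* s1, s2, s3 are the elementary symmetric functions of the roots of a monic cubic with
   prescribed values at 0, 1, b/a; the last factor on the left is its discriminant. *)
Lemma discriminant_of_interpolated_cubic (a c s1 s2 s3 : C) :
  a <> 0 -> c <> 0 -> a + c <> 0 ->
  let b := a + c in
  - s3 = - (b^3 / (4*(a^2*c))) ->
  1 - s1 + s2 - s3 = - (c/(4*b)) ->
  (b/a)^3 - s1*(b/a)^2 + s2*(b/a) - s3 = - (b*c^3/(4*a^4)) ->
  16*a^5*(s1^2*s2^2 - 4*s2^3 - 4*(s1^3*s3) + 18*(s1*s2*s3) - 27*s3^2)
  = b*c*(b^3 - 8*(b^2*c) + 5*(b*c^2) + c^3).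
Proof.
move=> ha hc hb b h1 h2 h3.
have h4 : RtoC 4 <> 0 by apply: RtoC_neq0; lra.
have e3 : s3 = b^3 / (4*(a^2*c)).
  replace s3 with (- - s3) by ring. by rewrite h1; ring.
have e2 : s2 = - (c/(4*b)) - 1 + s1 + s3 by rewrite -h2; ring.
have e1 : s1 = ((b/a)^3 + (b/a)*(- (c/(4*b)) - 1 + s3) - s3 + (b*c^3/(4*a^4)))*(a*a/(b*c)).
  have h5 : s1 * (b*c/(a*a)) = (b/a)^3 + (b/a)*(- (c/(4*b)) - 1 + s3) - s3 + (b*c^3/(4*a^4)).
    replace (b*c^3/(4*a^4)) with (-(- (b*c^3/(4*a^4)))) by ring.
    rewrite -h3 e2 /b; field. by repeat split.
  rewrite -h5 /b; field. by repeat split.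
rewrite e2 e1 e3 /b. field. by repeat split.
Qed.

(** Weierstrass coordinate with double pole at z = 1, normalised to vanish at the base point w; only
    differences matter, and these do not depend on w. *)
Definition xcoord (s w z : C) : C := bracket s z w / (bracket s z 1 * bracket s w 1).

Lemma xcoord_sub (s w x y : C) : s <> 0 -> Cmod s < 1 -> w <> 0 -> x <> 0 -> y <> 0 ->
  bracket s w 1 <> 0 -> bracket s x 1 <> 0 -> bracket s y 1 <> 0 ->
  xcoord s w x - xcoord s w y = bracket s x y / (bracket s x 1 * bracket s y 1).
Proof.
move=> hs hs1 hw hx hy h1 h2 h3.
have H := bracket_pluecker s x y w 1 hs hs1 hx hy hw C1_neq0.
rewrite /xcoord.
have -> : bracket s x y = (bracket s x w * bracket s y 1 - bracket s x 1 * bracket s y w) / bracket s w 1.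
  replace (bracket s x w * bracket s y 1 - bracket s x 1 * bracket s y w)
    with (bracket s x y * bracket s w 1 - 0) by (rewrite -H; ring).
  by field.
field. by repeat split.
Qed.

Section HalfPeriods.
Variable s : C.
Hypothesis hs : s <> 0.
Hypothesis hs1 : Cmod s < 1.

Let P := qfac_inf (s * s).

Lemma bracket_one (z : C) : bracket s z 1 = theta s z ^ 2 / z.
Proof.
rewrite /bracket. have -> : z * 1 = z by ring. have -> : z / 1 = z by field. rewrite /Cdiv. ring.
Qed.

Lemma theta_shift (z : C) : z <> 0 -> theta s (z / s) = - (z / s) * theta s (s * z).
Proof.
move=> hz. have := theta_quasi_period s (z / s) hs hs1 ltac:(by nz).
have -> : s * s * (z / s) = s * z by field.
move=> h. replace (theta s (z / s)) with (- - theta s (z / s)) by ring. rewrite -h. ring.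
Qed.

(** At a half period e the points z e and z / e agree modulo powers of s^2, so the bracket is a
    theta square up to an elementary factor: X(z) - X(e) has a double zero at e. *)
Lemma bracket_minus_one (z : C) : z <> 0 -> bracket s z (-(1)) = theta s (- z) ^ 2 / z.
Proof.
move=> hz. rewrite /bracket. have -> : z * -(1) = - z by ring.
have -> : z / -(1) = - z by field. rewrite /Cdiv. ring.
Qed.

Lemma bracket_half (z : C) : z <> 0 -> bracket s z s = - (theta s (s * z) ^ 2 / s).
Proof.
move=> hz. rewrite /bracket theta_shift //. have -> : z * s = s * z by ring. field. by split.
Qed.

Lemma bracket_minus_half (z : C) : z <> 0 -> bracket s z (- s) = theta s (- (s * z)) ^ 2 / s.
Proof.
move=> hz. rewrite /bracket. have -> : z / - s = (- z) / s by field.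
rewrite theta_shift; last by nz.
have -> : z * - s = - (s * z) by ring. have -> : s * - z = - (s * z) by ring.
field. by split.
Qed.

Lemma P_neq0 : P <> 0.
Proof. apply: qfac_inf_neq0; [by nz|exact: Cmod_sqr_lt1]. Qed.

Lemma theta_duplication (z : C) : z <> 0 ->
  theta s z * theta s (- z) * (theta s (s * z) * theta s (- (s * z))) = P ^ 3 * theta s (z * z).
Proof.
move=> hz. rewrite !theta_product //; try by nz.
rewrite -theta_prod_duplication // -/P. ring.
Qed.

Lemma theta_half_periods : theta s (-(1)) * theta s s * theta s (- s) = 2 * P ^ 3.
Proof.
rewrite !theta_product //; try by nz.
rewrite -(theta_prod_half_periods s hs hs1) -/P. ring.
Qed.

Lemma Cmult_neq0_l (x y : C) : x * y <> 0 -> x <> 0.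
Proof. by move=> h e; apply: h; rewrite e Cmult_0_l. Qed.

Lemma Cmult_neq0_r (x y : C) : x * y <> 0 -> y <> 0.
Proof. by move=> h e; apply: h; rewrite e Cmult_0_r. Qed.

Lemma theta_half_periods_neq0 : theta s (-(1)) <> 0 /\ theta s s <> 0 /\ theta s (- s) <> 0.
Proof.
have h : theta s (-(1)) * theta s s * theta s (- s) <> 0.
  rewrite theta_half_periods. apply: Cmult_neq_0; [apply: RtoC_neq0; lra|apply: Cpow_nz; exact: P_neq0].
have h' := Cmult_neq0_l _ _ h.
split; first exact: Cmult_neq0_l h'. split; first exact: Cmult_neq0_r h'. exact: Cmult_neq0_r h.
Qed.

(** Multiplicative form of the equation relating the square of the derivative to the cubic. By the
    half-period brackets the numerator is a square; duplication merges its theta values into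
    theta(z^2), and [theta_half_periods] turns the denominator into (2 P^3)^2, where P cancels and 4
    remains. *)
Lemma cubic_at_xcoord (w z : C) : w <> 0 -> z <> 0 -> theta s w <> 0 -> theta s z <> 0 ->
  (xcoord s w z - xcoord s w (-(1))) * (xcoord s w z - xcoord s w s)
    * (xcoord s w z - xcoord s w (- s))
  = - (z ^ 2 * theta s (z * z) ^ 2 / (4 * theta s z ^ 8)).
Proof.
move=> hw hz hw0 hz0. have [ha [hb hc]] := theta_half_periods_neq0.
have h4 : RtoC 4 <> 0 by apply: RtoC_neq0; lra.
have h2 : RtoC 2 <> 0 by apply: RtoC_neq0; lra.
rewrite !xcoord_sub //; try (rewrite bracket_one; nz); try by nz.
rewrite bracket_minus_one // bracket_half // bracket_minus_half // !bracket_one.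
have hP := P_neq0.
have e1 : theta s (- z) * theta s (s * z) * theta s (- (s * z)) = P ^ 3 * theta s (z * z) / theta s z.
  rewrite -theta_duplication //. by field.
have e2 := theta_half_periods.
transitivity (- (z ^ 2 * (theta s (- z) * theta s (s * z) * theta s (- (s * z))) ^ 2
   / (theta s z ^ 6 * (theta s (-(1)) * theta s s * theta s (- s)) ^ 2))).
  field. by repeat split.
rewrite e1 e2. field. by repeat split.
Qed.

(** Each difference of roots is a quotient of theta values at half periods, and the squared product
    depends only on the product 2 P^3 of these values: its fourth power is 16 P^12. *)
Lemma cubic_discriminant (w : C) : w <> 0 -> theta s w <> 0 ->
  ((xcoord s w (-(1)) - xcoord s w s) * (xcoord s w (-(1)) - xcoord s w (- s))
    * (xcoord s w s - xcoord s w (- s))) ^ 2 = s ^ 2 / (16 * P ^ 12).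
Proof.
move=> hw hw0. have [ha [hb hc]] := theta_half_periods_neq0.
have h16 : RtoC 16 <> 0 by apply: RtoC_neq0; lra.
have h2 : RtoC 2 <> 0 by apply: RtoC_neq0; lra.
have hP := P_neq0.
rewrite !xcoord_sub //; try (rewrite bracket_one; nz); try by nz.
rewrite bracket_half ?bracket_minus_half //; try by nz.
rewrite !bracket_one.
have -> : s * -(1) = - s by ring. have -> : - - s = s by ring.
(* The bracket of s and -s produces the point -s^2, which quasi-periodicity moves back to the half
   period -1. *)
have -> : theta s (- (s * s)) = theta s (-(1)).
  have := theta_quasi_period s (-(1)) hs hs1 ltac:(by nz).
  have -> : s * s * -(1) = - (s * s) by ring. move=> h.
  replace (theta s (- (s * s))) with (- (theta s (- (s * s)) * -(1))) by ring. rewrite h. ring.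
have e2 := theta_half_periods.
transitivity (s ^ 2 / (theta s (-(1)) * theta s s * theta s (- s)) ^ 4).
  field. by repeat split.
rewrite e2. field. by repeat split.
Qed.

End HalfPeriods.

(** * Seven-torsion *)

Section Septic.
Variables q s : C.
Hypothesis hq : q <> 0.
Hypothesis hq1 : Cmod q < 1.
Hypothesis hs2 : s * s = q ^ 7.

Lemma septic_s_neq0 : s <> 0.
Proof. move=> e. apply: (Cpow_nz q 7 hq). rewrite -hs2 e. ring. Qed.

Lemma septic_s_lt1 : Cmod s < 1.
Proof.
have h : (Cmod s * Cmod s = Cmod q ^ 7)%R by rewrite -Cmod_mult hs2 Cmod_pow.
have h0 := Cmod_ge_0 q.
have := pow_le_compat_exp (Cmod q) 1 7 ltac:(lra) ltac:(lia). rewrite [(_ ^ 1)%R]/=.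
have := Cmod_ge_0 s. nra.
Qed.

Lemma septic_theta_neq0 j : (1 <= j <= 6)%nat -> theta s (q ^ j) <> 0.
Proof.
move=> hj. have hs := septic_s_neq0. have hs1 := septic_s_lt1.
have /Cmod_gt_0 h0 := hq.
have hj1 : Cmod (q ^ j) < 1.
  rewrite Cmod_pow. have := pow_le_compat_exp (Cmod q) 1 j ltac:(lra) ltac:(lia). rewrite [(_ ^ 1)%R]/=. lra.
apply: theta_neq0 => //.
- rewrite hs2 !Cmod_pow. have -> : 7%nat = (j + (7 - j))%nat by lia. rewrite pow_add.
  have h1 : (0 < Cmod q ^ j)%R by exact: pow_lt.
  have := pow_le_compat_exp (Cmod q) 1 (7 - j) ltac:(lra) ltac:(lia). rewrite [(_ ^ 1)%R]/=. nra.
- lra.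
- move=> e. rewrite e Cmod_1 in hj1. lra.
Qed.

Let t1 := theta s q.
Let t2 := theta s (q ^ 2).
Let t3 := theta s (q ^ 3).

Lemma septic_neq0 : t1 <> 0 /\ t2 <> 0 /\ t3 <> 0.
Proof.
have h1 := septic_theta_neq0 1 ltac:(lia). rewrite Cpow_1_r in h1.
split; [done|split]; apply: septic_theta_neq0; lia.
Qed.

(** As q^7 is the period, the values at q^4, q^5, q^6 repeat [t3], [t2], [t1]. *)
Lemma septic_reflect i j : (i + j = 7)%nat -> theta s (q ^ i) = theta s (q ^ j).
Proof.
move=> hij. rewrite -(theta_reflect s (q ^ j)); [|exact: septic_s_neq0|exact: septic_s_lt1|exact: Cpow_nz].
congr theta. rewrite hs2 -hij Cpow_add_r. field. exact: Cpow_nz.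
Qed.

(** The sum k and the difference l are parameters, so that no truncated subtraction appears in the
    exponents. *)
Lemma septic_bracket i j k l : (i + j = k)%nat -> (j + l = i)%nat ->
  bracket s (q ^ i) (q ^ j) = theta s (q ^ k) * theta s (q ^ l) / q ^ i.
Proof.
move=> <- <-. rewrite /bracket !Cpow_add_r. congr (_ * theta s _ / _). field. exact: Cpow_nz.
Qed.

Let X j := xcoord s q (q ^ j).

Lemma septic_sub i j k l : (1 <= i <= 6)%nat -> (1 <= j <= 6)%nat -> (i + j = k)%nat -> (j + l = i)%nat ->
  X i - X j = theta s (q ^ k) * theta s (q ^ l) * q ^ j / (theta s (q ^ i) ^ 2 * theta s (q ^ j) ^ 2).
Proof.
move=> hi hj hk hl.
have hs := septic_s_neq0. have hs1 := septic_s_lt1.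
have hi0 := septic_theta_neq0 i hi. have hj0 := septic_theta_neq0 j hj.
have [h1 _] := septic_neq0.
rewrite /X xcoord_sub //; try (rewrite bracket_one; nz); try by nz.
rewrite (septic_bracket i j k l) // !bracket_one. field. repeat split => //; exact: Cpow_nz.
Qed.

(** [a], [b], [c] are A, B, C multiplied by q^(1/8); this removes the fractional powers and leaves
    one factor q in [c]. *)
Let a := t3 ^ 2 / t2.
Let b := t2 ^ 2 / t1.
Let c := q * t1 ^ 2 / t3.

Lemma septic_differences :
  X 2 - X 1 = q * t3 / (t1 * t2 ^ 2) /\ X 3 - X 1 = q * t2 / (t3 * t1 ^ 2) /\
  X 3 - X 2 = q ^ 2 * t1 / (t3 ^ 2 * t2).
Proof.
have [h1 [h2 h3]] := septic_neq0.
rewrite (septic_sub 2 1 3 1) //; try lia. rewrite (septic_sub 3 1 4 2) //; try lia.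
rewrite (septic_sub 3 2 5 1) //; try lia.
rewrite (septic_reflect 4 3) // (septic_reflect 5 2) // !Cpow_1_r -/t1 -/t2 -/t3.
by repeat split; field; repeat split.
Qed.

(** This is X 3 - X 1 = (X 3 - X 2) + (X 2 - X 1), multiplied by t1 t2 t3 / q. *)
Lemma septic_linear : a + c = b.
Proof.
have [h1 [h2 h3]] := septic_neq0. have [e1 [e2 e3]] := septic_differences.
have e : q * t2 / (t3 * t1 ^ 2) = q ^ 2 * t1 / (t3 ^ 2 * t2) + q * t3 / (t1 * t2 ^ 2).
  rewrite -e1 -e2 -e3. ring.
have e4 : b = q * t2 / (t3 * t1 ^ 2) * (t1 * t2 * t3 / q) by rewrite /b; field; repeat split.
rewrite e4 e /a /c. field. by repeat split.
Qed.

(** When the two values of the discriminant are equated, everything except the cubic form in b and c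
    is a monomial in q, [t1], [t2], [t3] and the 12th power of the product; the monomial collapses
    to (t1 t2 t3)^5. *)
Lemma septic_cubic :
  qfac_inf (q ^ 7) ^ 12 * (b ^ 3 - 8 * (b ^ 2 * c) + 5 * (b * c ^ 2) + c ^ 3) = (t1 * t2 * t3) ^ 5.
Proof.
have hs := septic_s_neq0. have hs1 := septic_s_lt1.
have [h1 [h2 h3]] := septic_neq0. have [d1 [d2 d3]] := septic_differences.
have ha : a <> 0 by rewrite /a; nz. have hb : b <> 0 by rewrite /b; nz.
have hc : c <> 0 by rewrite /c; nz.
have h4 : RtoC 4 <> 0 by apply: RtoC_neq0; lra.
have h16 : RtoC 16 <> 0 by apply: RtoC_neq0; lra.
have hP := P_neq0 s hs hs1. rewrite hs2 in hP.
set e1 := xcoord s q (-(1)). set e2 := xcoord s q s. set e3 := xcoord s q (- s).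
pose D := q * t3 / (t1 * t2 ^ 2).
have hD : D <> 0 by rewrite /D; nz.
have value j k : (1 <= j <= 3)%nat -> (j + j = k)%nat ->
    (X j - e1) * (X j - e2) * (X j - e3) = - (q ^ k * theta s (q ^ k) ^ 2 / (4 * theta s (q ^ j) ^ 8)).
  move=> hj <-. rewrite /X cubic_at_xcoord //; try exact: Cpow_nz; try (apply: septic_theta_neq0; lia).
  by rewrite !Cpow_add_r; congr (- (_ / _)); ring.
(* The doubled points are q^2, q^4, q^6, with theta values [t2], [t3], [t1] by reflection, so no new
   theta values enter. *)
have v1 := value 1%nat 2%nat ltac:(lia) ltac:(lia).
have v2 := value 2%nat 4%nat ltac:(lia) ltac:(lia).
have v3 := value 3%nat 6%nat ltac:(lia) ltac:(lia).
rewrite (septic_reflect 4 3) // in v2. rewrite (septic_reflect 6 1) // in v3.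
rewrite !Cpow_1_r -/t1 -/t2 -/t3 in v1 v2 v3.
(* Normalised so that q, q^2, q^3 have coordinates 0, 1, b/a. *)
pose f1 := (e1 - X 1) / D. pose f2 := (e2 - X 1) / D. pose f3 := (e3 - X 1) / D.
have D2 : X 2 = X 1 + D by rewrite /D -d1; ring.
have ba : X 3 = X 1 + D * (b / a).
  replace (X 3) with (X 1 + (X 3 - X 1)) by ring. rewrite d2 /D /b /a. field. by repeat split.
have w1 : - (f1 * f2 * f3) = - (b ^ 3 / (4 * (a ^ 2 * c))).
  transitivity ((X 1 - e1) * (X 1 - e2) * (X 1 - e3) / D ^ 3); first by rewrite /f1 /f2 /f3; field.
  rewrite v1 /D /a /b /c. field. by repeat split.
have w2 : 1 - (f1 + f2 + f3) + (f1 * f2 + f1 * f3 + f2 * f3) - f1 * f2 * f3 = - (c / (4 * (a + c))).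
  transitivity ((X 2 - e1) * (X 2 - e2) * (X 2 - e3) / D ^ 3).
    by rewrite D2 /f1 /f2 /f3; field.
  rewrite v2 septic_linear /D /a /b /c. field. by repeat split.
have w3 : ((a + c) / a) ^ 3 - (f1 + f2 + f3) * ((a + c) / a) ^ 2
   + (f1 * f2 + f1 * f3 + f2 * f3) * ((a + c) / a) - f1 * f2 * f3 = - ((a + c) * c ^ 3 / (4 * a ^ 4)).
  transitivity ((X 3 - e1) * (X 3 - e2) * (X 3 - e3) / D ^ 3).
    rewrite ba septic_linear /f1 /f2 /f3. field. by repeat split.
  rewrite v3 septic_linear /D /a /b /c. field. by repeat split.
have w1' : - (f1 * f2 * f3) = - ((a + c) ^ 3 / (4 * (a ^ 2 * c))) by rewrite septic_linear.
have hac : a + c <> 0 by rewrite septic_linear.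
have H := discriminant_of_interpolated_cubic a c _ _ _ ha hc hac w1' w2 w3.
cbv zeta in H. rewrite septic_linear in H.
have hdisc := cubic_discriminant s hs hs1 q hq h1. rewrite -/e1 -/e2 -/e3 hs2 in hdisc.
(* Translating the roots by X 1 leaves the discriminant unchanged; dividing them by D divides it by
   D^6. *)
have Hf : ((f1 - f2) * (f1 - f3) * (f2 - f3)) ^ 2 = q ^ 7 / (16 * qfac_inf (q ^ 7) ^ 12) / D ^ 6.
  have es : s ^ 2 = q ^ 7 by rewrite -hs2; ring.
  rewrite es in hdisc. rewrite -hdisc /f1 /f2 /f3. field. done.
replace (16 * a ^ 5 *
    ((f1 + f2 + f3) ^ 2 * (f1 * f2 + f1 * f3 + f2 * f3) ^ 2 - 4 * (f1 * f2 + f1 * f3 + f2 * f3) ^ 3 -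
     4 * ((f1 + f2 + f3) ^ 3 * (f1 * f2 * f3)) +
     18 * ((f1 + f2 + f3) * (f1 * f2 + f1 * f3 + f2 * f3) * (f1 * f2 * f3)) - 27 * (f1 * f2 * f3) ^ 2))
  with (16 * a ^ 5 * ((f1 - f2) * (f1 - f3) * (f2 - f3)) ^ 2) in H by ring.
rewrite Hf in H.
transitivity (qfac_inf (q ^ 7) ^ 12 / (b * c) * (b * c * (b ^ 3 - 8 * (b ^ 2 * c) + 5 * (b * c ^ 2) + c ^ 3))).
  field. by split.
rewrite -H /a /b /c /D. field. by repeat split.
Qed.

End Septic.

(** * The complex exponential and termwise differentiation *)

Lemma C_eq (x y : C) : Re x = Re y -> Im x = Im y -> x = y.
Proof. case: x => a b; case: y => c d /= -> ->. done. Qed.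

Lemma cexp_add z w : cexp (z + w) = cexp z * cexp w.
Proof.
case: z => a b; case: w => c d. rewrite /cexp /=.
rewrite exp_plus cos_plus sin_plus. by apply: C_eq => /=; ring.
Qed.

Lemma cexp_0 : cexp 0 = 1.
Proof. rewrite /cexp /= exp_0 cos_0 sin_0. by apply: C_eq => /=; ring. Qed.

Lemma Cmod_cexp z : Cmod (cexp z) = exp (Re z).
Proof.
rewrite /cexp Cmod_mult Cmod_R Rabs_pos_eq; last by apply/Rlt_le/exp_pos.
have -> : Cmod (cos (Im z) + Ci * sin (Im z)) = 1%R; last by ring.
rewrite /Cmod /= -[RHS]sqrt_1. congr sqrt.
have := sin2_cos2 (Im z). rewrite /Rsqr => h. apply: eq_trans h. ring.
Qed.

Lemma cexp_neq0 z : cexp z <> 0.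
Proof. apply/Cmod_gt_0. rewrite Cmod_cexp. exact: exp_pos. Qed.

Lemma Rabs_sin_le x : Rabs (sin x) <= Rabs x.
Proof.
have key t : (0 < t)%R -> Rabs (sin t) <= t.
  move=> h. apply: Rabs_le. split; last by apply/Rlt_le/sin_lt_x.
  case: (Rle_lt_dec t 1) => h1; last by have := SIN_bound t; lra.
  have : 0 <= sin t by apply: sin_ge_0; have := PI2_1; lra. lra.
case: (Rtotal_order x 0) => [h|[->|h]].
- rewrite -(Rabs_Ropp (sin x)) -sin_neg -(Rabs_Ropp x) (Rabs_pos_eq (- x)); last lra.
  apply: key. lra.
- rewrite sin_0. lra.
- rewrite (Rabs_pos_eq x); last lra. exact: key.
Qed.

Lemma one_sub_cos x : (1 - cos x = 2 * (sin (x / 2) * sin (x / 2)))%R.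
Proof.
have := cos_2a_sin (x / 2). have -> : (2 * (x / 2) = x)%R by field. lra.
Qed.

Lemma one_sub_cos_le x : 0 <= 1 - cos x <= Rabs x /\ 1 - cos x <= x * x.
Proof.
have h := Rabs_sin_le (x / 2). rewrite one_sub_cos.
have e : Rabs (x / 2) = (Rabs x / 2)%R by rewrite /Rdiv Rabs_mult (Rabs_pos_eq (/2)); lra.
rewrite e in h. have h0 := Rabs_pos (sin (x / 2)).
have e2 : (sin (x/2) * sin (x/2) = Rabs (sin (x/2)) * Rabs (sin (x/2)))%R.
  rewrite -Rabs_mult Rabs_pos_eq //. nra.
have h1 : Rabs (sin (x / 2)) <= 1 by apply: Rabs_le; have := SIN_bound (x / 2); lra.
have e3 : (x * x = Rabs x * Rabs x)%R by rewrite -Rabs_mult Rabs_pos_eq //; nra.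
rewrite e2 e3. nra.
Qed.

Lemma Rabs_sub_sin x : Rabs (x - sin x) <= x * x.
Proof.
have [c [hc e]] := MVT_gen (fun t => t - sin t)%R 0 x (fun t => 1 - cos t)%R
  ltac:(move=> t _; auto_derive => //; ring)
  ltac:(move=> t _; apply: continuity_pt_minus; [exact: derivable_continuous_pt (derivable_pt_id t)|exact: continuity_sin]).
rewrite sin_0 in e. have -> : (x - sin x = (1 - cos c) * (x - 0))%R by lra.
rewrite Rabs_mult Rminus_0_r.
have [h _] := one_sub_cos_le c. rewrite (Rabs_pos_eq (1 - cos c)); last lra.
have e3 : (x * x = Rabs x * Rabs x)%R by rewrite -Rabs_mult Rabs_pos_eq //; nra.
rewrite e3. apply: Rmult_le_compat_r; first exact: Rabs_pos.
apply: (Rle_trans _ (Rabs c)); first lra.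
move: hc. rewrite /Rmin /Rmax. case: Rle_dec => h1 [h2 h3].
  rewrite !Rabs_pos_eq; lra.
rewrite !Rabs_left1; lra.
Qed.

Lemma exp_remainder a : Rabs (exp a - 1 - a) <= a * a * exp (Rabs a).
Proof.
have h1 := exp_ineq1_le a. rewrite Rabs_pos_eq; last lra.
have h2 := exp_ineq1_le (- a).
have e : (exp a * exp (- a) = 1)%R by rewrite -exp_plus Rplus_opp_r exp_0.
have hp := exp_pos a.
case: (Rle_lt_dec 0 a) => h.
  rewrite Rabs_pos_eq //. have h3 : exp a - 1 <= a * exp a by nra. nra.
rewrite Rabs_left //.
have h3 : 1 - exp a <= - a by lra.
have h4 : - a * exp a <= 1 - exp a.
  have : exp a * (1 - a) <= 1.
    rewrite -[X in _ <= X]e. apply: Rmult_le_compat_l; lra.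
  lra.
have h5 : exp a - 1 - a <= a * a by nra.
have h6 : 1 <= exp (- a) by lra. nra.
Qed.

Lemma cexp_remainder w : Cmod (cexp w - 1 - w) <= 3 * Cmod w ^ 2 * exp (Cmod w).
Proof.
have hre := re_le_Cmod w. have him := im_le_Cmod w.
have e2 := Cmod2_alt w.
case: w hre him e2 => a b /= hre him e2. set m := Cmod (a, b) in hre him e2 *.
have hm : 0 <= m by exact: Cmod_ge_0.
pose cis := cos b + Ci * sin b.
have hcis : Cmod cis = 1%R.
  have := Cmod_cexp (0, b)%R. rewrite /cexp /= exp_0 Cmult_1_l. done.
(* Separates the remainders of the real exponential and of cos b + i sin b; the mixed term a (cis -
   1) is of second order because 2|a||b| <= a^2 + b^2. *)
have -> : cexp (a, b) - 1 - (a, b) = RtoC (exp a - 1 - a) * cis + ((cis - 1 - Ci * b) + RtoC a * (cis - 1)).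
  by rewrite /cexp /cis; apply: C_eq => /=; ring.
have [[h10' h1] h1'] := one_sub_cos_le b. have h2 := Rabs_sub_sin b. have h3 := Rabs_sin_le b.
have b1 : Cmod (cis - 1 - Ci * b) <= 2 * (b * b).
  apply: Rle_trans; first exact: Cmod_le_Rabs. rewrite /cis /=.
  have -> : (cos b + (0 * sin b - 1 * 0) + - (1) + - (0 * b - 1 * 0) = - (1 - cos b))%R by ring.
  have -> : (0 + (0 * 0 + 1 * sin b) + - 0 + - (0 * 0 + 1 * b) = - (b - sin b))%R by ring.
  rewrite !Rabs_Ropp (Rabs_pos_eq (1 - cos b)); lra.
have b2 : Cmod (cis - 1) <= 2 * Rabs b.
  apply: Rle_trans; first exact: Cmod_le_Rabs. rewrite /cis /=.
  have -> : (cos b + (0 * sin b - 1 * 0) + - (1) = - (1 - cos b))%R by ring.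
  have -> : (0 + (0 * 0 + 1 * sin b) + - 0 = sin b)%R by ring.
  rewrite !Rabs_Ropp (Rabs_pos_eq (1 - cos b)); lra.
have t1 := Cmod_triangle (RtoC (exp a - 1 - a) * cis) ((cis - 1 - Ci * b) + RtoC a * (cis - 1)).
have t2 := Cmod_triangle (cis - 1 - Ci * b) (RtoC a * (cis - 1)).
rewrite !Cmod_mult !Cmod_R hcis in t1 t2.
have h4 := exp_remainder a.
have h5 : exp (Rabs a) <= exp m.
  case: (Rle_lt_or_eq_dec _ _ hre) => [h|->]; [exact/Rlt_le/exp_increasing|lra].
have h6 : 1 <= exp m by have := exp_ineq1_le m; lra.
have h7 : Rabs a * Cmod (cis - 1) <= a * a + b * b.
  have ea : (a * a = Rabs a * Rabs a)%R by rewrite -Rabs_mult Rabs_pos_eq //; nra.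
  have eb : (b * b = Rabs b * Rabs b)%R by rewrite -Rabs_mult Rabs_pos_eq //; nra.
  apply: (Rle_trans _ (Rabs a * (2 * Rabs b))); first by apply: Rmult_le_compat_l => //; exact: Rabs_pos.
  rewrite ea eb. have := pow2_ge_0 (Rabs a - Rabs b). lra.
have h8 : a * a * exp (Rabs a) <= a * a * exp m by apply: Rmult_le_compat_l => //; nra.
have e3 : (m * (m * 1) = a * a + b * b)%R by lra.
have h9 : 0 <= a * a by nra. have h10 : 0 <= b * b by nra.
rewrite e3. nra.
Qed.

Lemma qpow_arg_re a t : Re (RtoC (2 * PI * a) * (Ci * t)) = (- (2 * PI * a * Im t))%R.
Proof. case: t => x y /=. ring. Qed.

Lemma Cmod_qpow a t : Cmod (qpow a t) = exp (- (2 * PI * a * Im t)).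
Proof. by rewrite /qpow Cmod_cexp qpow_arg_re. Qed.

Lemma qpow_neq0 a t : qpow a t <> 0.
Proof. exact: cexp_neq0. Qed.

Lemma qpow_add a b t : qpow (a + b) t = qpow a t * qpow b t.
Proof.
rewrite /qpow -cexp_add. congr cexp.
have -> : (2 * PI * (a + b) = 2 * PI * a + 2 * PI * b)%R by ring. rewrite RtoC_plus. ring.
Qed.

Lemma qpow_0 t : qpow 0 t = 1.
Proof. rewrite /qpow Rmult_0_r Cmult_0_l. exact: cexp_0. Qed.

Lemma qpow_zpow a n t : qpow (IZR n * a) t = zpow (qpow a t) n.
Proof.
have h := qpow_neq0 a t.
elim/Z.peano_ind: n => [|n IH|n IH].
- by rewrite Rmult_0_l qpow_0.
- rewrite -Z.add_1_r zpow_add // zpow_1_r -IH -qpow_add plus_IZR. congr qpow. ring.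
- have -> : Z.pred n = (n + - (1))%Z by lia.
  rewrite zpow_add // zpow_opp // zpow_1_r -IH.
  have -> : qpow (IZR n * a) t = qpow (IZR (n + - (1)) * a) t * qpow a t.
    rewrite -qpow_add plus_IZR opp_IZR. congr qpow. ring.
  by field.
Qed.

Lemma qpow_pow a n t : qpow (INR n * a) t = qpow a t ^ n.
Proof. by rewrite INR_IZR_INZ qpow_zpow zpow_of_nat. Qed.

Lemma qpow_scale a b t : qpow a (RtoC b * t) = qpow (b * a) t.
Proof.
rewrite /qpow. congr cexp. rewrite !RtoC_mult. ring.
Qed.

(** A quadratic remainder bound on a fixed disc reduces differentiability to an explicit inequality,
    which can be summed term by term. *)
Lemma holo_at_of_remainder (f : C -> C) (z D : C) (B d : R) : (0 < d)%R ->
  (forall h, Cmod h < d -> Cmod (f (z + h) - f z - D * h) <= B * Cmod h ^ 2) -> holo_at f z.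
Proof.
move=> hd H. exists D. split; first exact: is_linear_scal_l.
move=> x hx. have <- := @is_filter_lim_locally_unique _ (AbsRing_NormedModule C_AbsRing) z x hx.
move=> {x hx} eps.
have hB : (0 < Rabs B + 1)%R by have := Rabs_pos B; lra.
have he : (0 < Rmin d (eps / (Rabs B + 1)))%R.
  by apply: Rmin_pos => //; apply: Rdiv_lt_0_compat => //; exact: cond_pos.
have key (y : C) : Cmod (y - z) < Rmin d (eps / (Rabs B + 1)) ->
    Cmod (f y - f z - (y - z) * D) <= eps * Cmod (y - z); last first.
  exists (mkposreal _ he) => y hy. exact: key hy.
move=> hy.
have h1 : Cmod (y - z) < d by apply: Rlt_le_trans hy (Rmin_l _ _).
have h2 : Cmod (y - z) < eps / (Rabs B + 1) by apply: Rlt_le_trans hy (Rmin_r _ _).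
have := H (y - z) h1. replace (z + (y - z)) with y by ring. rewrite (Cmult_comm D) => h3.
apply: Rle_trans; first exact: h3.
have h0 := Cmod_ge_0 (y - z). rewrite /= Rmult_1_r -Rmult_assoc. apply: Rmult_le_compat_r => //.
have h4 : Cmod (y - z) * (Rabs B + 1) <= eps.
  apply: (Rle_trans _ (eps / (Rabs B + 1) * (Rabs B + 1))).
    apply: Rmult_le_compat_r; lra.
  right. field. lra.
have := Rle_abs B. nra.
Qed.

Lemma sqr_le_exp x : 0 <= x -> x * x <= 4 * exp x.
Proof.
move=> h. have h1 := exp_ineq1_le (x / 2).
have e : (exp x = exp (x / 2) * exp (x / 2))%R by rewrite -exp_plus; congr exp; field.
rewrite e. have h2 := exp_pos (x/2). nra.
Qed.

Lemma exp_le_compat x y : x <= y -> exp x <= exp y.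
Proof. by case/Rle_lt_or_eq_dec => [h|->]; [exact/Rlt_le/exp_increasing|lra]. Qed.

Lemma exp_pow x n : (exp x ^ n = exp (INR n * x))%R.
Proof.
elim: n => [|n IH]; first by rewrite Rmult_0_l exp_0.
rewrite S_INR /= IH -exp_plus. congr exp. ring.
Qed.

(** Termwise differentiation: the series, the differentiated series and the second-order remainders
    all have geometric majorants in |n|, the last one with a factor |h|^2. *)
Lemma qseries_holo (sg : Z -> C) (al : Z -> R) (t : C) :
  (forall n, Cmod (sg n) <= 1) -> (forall n, INR (Z.abs_nat n) <= al n) -> upper_half t ->
  holo_at (fun x => ZS (fun n => sg n * qpow (al n) x)) t.
Proof.
move=> hsg hal hY. rewrite /upper_half in hY. set Y := Im t in hY.
have hPI := PI_RGT_0.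
(* A quarter of the decay rate 2 pi Y. With x = c * al n the term decays like exp(-4x); for |h| <
   Y/2 the exponential in the remainder costs at most exp(2x), the factor x^2 costs 4 exp(x), and
   exp(-x) <= r^|n| is left. *)
set c := (PI * Y / 2)%R. have hc : (0 < c)%R by rewrite /c; nra.
set r := exp (- c).
have hr : 0 <= r < 1.
  split; first exact/Rlt_le/exp_pos. rewrite /r -exp_0. apply: exp_increasing. lra.
have hal0 n : 0 <= al n by apply: Rle_trans (hal n); exact: pos_INR.
have hpa n : 0 <= PI * al n by apply: Rmult_le_pos => //; lra.
have hrn n : exp (- (c * al n)) <= r ^ Z.abs_nat n.
  rewrite /r exp_pow. apply: exp_le_compat. have := hal n. nra.
(* Obtained from an existential, [ip] is opaque and is unfolded only through [eip]. *)
have [ip eip] : exists ip : Z -> C, forall n, ip n = RtoC (2 * PI * al n) * Ci by exists (fun n => RtoC (2 * PI * al n) * Ci).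
have cip n : Cmod (ip n) = (2 * PI * al n)%R.
  rewrite eip Cmod_mult Cmod_R Cmod_Ci Rmult_1_r Rabs_pos_eq //.
  have := hal0 n. nra.
have dbase y : Y / 2 <= Im y -> zdom 1 r (fun n => sg n * qpow (al n) y).
  move=> hy n. rewrite Cmod_mult Cmod_qpow.
  have h1 : exp (- (2 * PI * al n * Im y)) <= exp (- (c * al n)).
    apply: exp_le_compat. rewrite /c.
    have h2 : PI * al n * (Y / 2) <= PI * al n * Im y by apply: Rmult_le_compat_l.
    have h3 : 0 <= PI * al n * (Y / 2) by apply: Rmult_le_pos => //; lra.
    nra.
  have h4 := hrn n. have h5 := hsg n. have h6 := Cmod_ge_0 (sg n).
  have h7 := exp_pos (- (2 * PI * al n * Im y)). nra.
have dder : zdom (4 / Y) r (fun n => sg n * (ip n * qpow (al n) t)).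
  move=> n. rewrite Cmod_mult Cmod_mult cip Cmod_qpow -/Y.
  set x := (c * al n)%R. have hx : 0 <= x by apply: Rmult_le_pos => //; lra.
  have h4 : exp (- x) <= r ^ Z.abs_nat n by exact: hrn.
  have -> : (2 * PI * al n * Y = 4 * x)%R by rewrite /x /c; field.
  have -> : (2 * PI * al n = 4 / Y * x)%R by rewrite /x /c; field; lra.
  have h1 : x * exp (- (4 * x)) <= exp (- x).
    have e1 : (exp (- x) = exp x * exp (- (2 * x)))%R by rewrite -exp_plus; congr exp; ring.
    have e2 : exp (- (4 * x)) <= exp (- (2 * x)) by apply: exp_le_compat; lra.
    have e3 := exp_ineq1_le x. rewrite e1. apply: Rmult_le_compat; try lra. exact/Rlt_le/exp_pos.
  have h2 : (0 < 4 / Y)%R by apply: Rdiv_lt_0_compat; lra.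
  have h5 := hsg n. have h6 := Cmod_ge_0 (sg n).
  have h7 : 0 <= 4 / Y * (x * exp (- (4 * x))).
    apply: Rmult_le_pos; first lra. apply: Rmult_le_pos => //. exact/Rlt_le/exp_pos.
  apply: (Rle_trans _ (1 * (4 / Y * (x * exp (- (4 * x)))))); last by rewrite Rmult_1_l; nra.
  rewrite (Rmult_assoc (4 / Y) x). by apply: Rmult_le_compat_r.
pose D := ZS (fun n => sg n * (ip n * qpow (al n) t)).
(* 192 = 3 * 4^2 * 4: the 3 comes from [cexp_remainder], 4 / Y from |ip n| = (4 / Y) x, the last 4
   from [sqr_le_exp]. The outer 2 / (1 - r) is the sum over Z in [ZS_bound]. *)
apply: (holo_at_of_remainder _ _ D (2 * (192 / Y ^ 2) / (1 - r)) (Y / 2)); first lra.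
move=> h hh.
have him := im_le_Cmod h.
have hth : Y / 2 <= Im (t + h).
  rewrite im_plus -/Y. have [] := Rabs_def2 (Im h) (Y / 2) ltac:(lra). lra.
pose rem n := sg n * (qpow (al n) t * (cexp (ip n * h) - 1 - ip n * h)).
have drem : zdom (192 / Y ^ 2 * Cmod h ^ 2) r rem.
  move=> n. rewrite /rem Cmod_mult Cmod_mult Cmod_qpow -/Y.
  set x := (c * al n)%R. have hx : 0 <= x by apply: Rmult_le_pos => //; lra.
  have h4 : exp (- x) <= r ^ Z.abs_nat n by exact: hrn.
  have -> : (2 * PI * al n * Y = 4 * x)%R by rewrite /x /c; field.
  have hw := cexp_remainder (ip n * h).
  have ew : Cmod (ip n * h) = (4 / Y * x * Cmod h)%R by rewrite Cmod_mult cip /x /c; field; lra.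
  rewrite ew in hw.
  have hY4 : 0 < 4 / Y by apply: Rdiv_lt_0_compat; lra.
  have hm := Cmod_ge_0 h.
  have hw2 : 4 / Y * x * Cmod h <= 2 * x.
    have -> : (2 * x = 4 / Y * x * (Y / 2))%R by field; lra.
    apply: Rmult_le_compat_l; [nra|lra].
  have he := exp_le_compat _ _ hw2.
  have hs2 := sqr_le_exp x hx.
  have h5 := hsg n. have h6 := Cmod_ge_0 (sg n).
  set Q := Cmod (cexp (ip n * h) - 1 - ip n * h) in hw *.
  have hQ0 : 0 <= Q by exact: Cmod_ge_0.
  have hE := exp_pos (- (4 * x)).
  apply: (Rle_trans _ (1 * (exp (- (4 * x)) * Q))).
    apply: Rmult_le_compat_r => //. by apply: Rmult_le_pos => //; lra.
  rewrite Rmult_1_l.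
  apply: (Rle_trans _ (exp (- (4 * x)) * (48 / Y ^ 2 * Cmod h ^ 2 * (x * x) * exp (2 * x)))).
    apply: Rmult_le_compat_l; first lra. apply: Rle_trans; first exact: hw.
    have -> : (3 * (4 / Y * x * Cmod h) ^ 2 = 48 / Y ^ 2 * Cmod h ^ 2 * (x * x))%R by field; lra.
    apply: Rmult_le_compat_l => //.
    have h8 : 0 < 48 / Y ^ 2 by apply: Rdiv_lt_0_compat; nra.
    have h9 := pow2_ge_0 (Cmod h). apply: Rmult_le_pos; last nra. apply: Rmult_le_pos; lra.
  have -> : (exp (- (4 * x)) * (48 / Y ^ 2 * Cmod h ^ 2 * (x * x) * exp (2 * x))
     = 48 / Y ^ 2 * Cmod h ^ 2 * (x * x * exp (- (2 * x))))%R.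
    have -> : (exp (- (2 * x)) = exp (- (4 * x)) * exp (2 * x))%R by rewrite -exp_plus; congr exp; ring.
    ring.
  have -> : (192 / Y ^ 2 * Cmod h ^ 2 * r ^ Z.abs_nat n = 48 / Y ^ 2 * Cmod h ^ 2 * (4 * r ^ Z.abs_nat n))%R.
    by field; lra.
  apply: Rmult_le_compat_l.
    have h8 : 0 < 48 / Y ^ 2 by apply: Rdiv_lt_0_compat; nra.
    have h9 := pow2_ge_0 (Cmod h). apply: Rmult_le_pos; lra.
  apply: (Rle_trans _ (4 * exp x * exp (- (2 * x)))).
    apply: Rmult_le_compat_r => //. exact/Rlt_le/exp_pos.
  have -> : (4 * exp x * exp (- (2 * x)) = 4 * exp (- x))%R.
    have -> : (exp (- x) = exp x * exp (- (2 * x)))%R by rewrite -exp_plus; congr exp; ring.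
    ring.
  lra.
have d1 := dbase (t + h) hth. have d0 := dbase t ltac:(rewrite -/Y; lra).
have e : ZS (fun n => sg n * qpow (al n) (t + h)) = ZS (fun n => sg n * qpow (al n) t) + (D * h + ZS rem).
  rewrite /D Cmult_comm -(ZS_scal (4 / Y) r) //.
  set M := (Rmax 1 (Rmax (Cmod h * (4 / Y)) (192 / Y ^ 2 * Cmod h ^ 2)))%R.
  have m1 : 1 <= M by exact: Rmax_l.
  have m2 : Cmod h * (4 / Y) <= M by apply: Rle_trans (Rmax_r _ _); exact: Rmax_l.
  have m3 : 192 / Y ^ 2 * Cmod h ^ 2 <= M by apply: Rle_trans (Rmax_r _ _); exact: Rmax_r.
  have k2 : zdom M r (fun n => h * (sg n * (ip n * qpow (al n) t))).
    apply: zdom_le (zdom_scal _ _ h _ dder); lra.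
  have k3 : zdom M r rem by apply: zdom_le drem; lra.
  rewrite -(ZS_plus M r) // -(ZS_plus (M + M) r) //.
  - apply: ZS_ext => n. rewrite /rem.
    have -> : qpow (al n) (t + h) = qpow (al n) t * cexp (ip n * h).
      rewrite /qpow -cexp_add eip. congr cexp. ring.
    ring.
  - apply: zdom_le d0; lra.
  - move=> n. apply: Rle_trans; first exact: Cmod_triangle. have := k2 n. have := k3 n. lra.
rewrite e.
replace (ZS (fun n => sg n * qpow (al n) t) + (D * h + ZS rem) - ZS (fun n => sg n * qpow (al n) t) - D * h)
  with (ZS rem) by ring.
apply: Rle_trans; first exact: ZS_bound hr drem. right. field. split; lra.
Qed.

(** * Calculus of holomorphic functions *)

Lemma holo_at_absring (f : C -> C) (z : C) :
  holo_at f z <-> @ex_derive C_AbsRing (AbsRing_NormedModule C_AbsRing) f z.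
Proof.
(* The two normed-module structures on [C] carry the same data, so a derivative for one is a
   derivative for the other; the product and chain rules refer to the structure coming from the
   absolute ring. *)
split=> -[d [hl hd]]; exists d; split; try exact: is_linear_scal_l; exact: hd.
Qed.

Lemma holo_at_mult (f g : C -> C) z : holo_at f z -> holo_at g z -> holo_at (fun x => f x * g x) z.
Proof.
move=> /holo_at_absring [df hf] /holo_at_absring [dg hg]. apply/holo_at_absring. eexists.
apply: (is_derive_mult (K := C_AbsRing) f g z df dg hf hg). move=> a b. exact: Cmult_comm.
Qed.

Lemma holo_at_minus (f g : C -> C) z : holo_at f z -> holo_at g z -> holo_at (fun x => f x - g x) z.
Proof. move=> [df hf] [dg hg]. eexists. exact: (is_derive_minus (K := C_AbsRing) (V := C_NormedModule) f g z df dg hf hg). Qed.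

Lemma holo_at_plus (f g : C -> C) z : holo_at f z -> holo_at g z -> holo_at (fun x => f x + g x) z.
Proof. move=> [df hf] [dg hg]. eexists. exact: (is_derive_plus (K := C_AbsRing) (V := C_NormedModule) f g z df dg hf hg). Qed.

Lemma holo_at_comp (f g : C -> C) z : holo_at f (g z) -> holo_at g z -> holo_at (fun x => f (g x)) z.
Proof. move=> [df hf] /holo_at_absring [dg hg]. eexists. exact: (is_derive_comp (K := C_AbsRing) (V := C_NormedModule) f g z df dg hf hg). Qed.

Lemma holo_at_ext (f g : C -> C) z : (forall x, upper_half x -> f x = g x) -> upper_half z ->
  holo_at f z -> holo_at g z.
Proof.
move=> h hz [d hf]. exists d. apply: is_derive_ext_loc hf.
have hp : (0 < Im z / 2)%R by rewrite /upper_half in hz; lra.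
exists (mkposreal _ hp) => y hy. apply: h.
have {}hy : Cmod (y - z) < Im z / 2 by exact: hy.
have := im_le_Cmod (y - z). rewrite /upper_half.
have -> : Im (y - z) = (Im y - Im z)%R by rewrite /Cminus im_plus im_opp; ring.
move=> h1. have [] := Rabs_def2 (Im y - Im z) (Im z / 2) ltac:(lra). lra.
Qed.

(** The remainder of 1/w is exactly h^2 / (w^2 (w + h)), and |w + h| >= |w|/2 for |h| < |w|/2. *)
Lemma holo_at_inv (f : C -> C) z : f z <> 0 -> holo_at f z -> holo_at (fun x => / f x) z.
Proof.
move=> h0 hf. apply: (holo_at_comp (fun y => / y)) hf.
set w := f z in h0 *. have /Cmod_gt_0 hw := h0.
apply: (holo_at_of_remainder _ _ (- / (w * w)) (2 / (Cmod w ^ 3)) (Cmod w / 2)); first lra.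
move=> h hh.
have h1 : (Cmod w / 2 <= Cmod (w + h))%R.
  have := Cmod_triangle (w + h) (- h). rewrite Cmod_opp.
  replace (w + h + - h) with w by ring. lra.
have hwh : w + h <> 0 by apply/Cmod_gt_0; lra.
replace (/ (w + h) - / w - - / (w * w) * h) with (h * h / (w * w * (w + h))) by (field; split; done).
rewrite Cmod_div; last by nz. rewrite !Cmod_mult.
have -> : (2 / Cmod w ^ 3 * Cmod h ^ 2 = Cmod h * Cmod h / (Cmod w * Cmod w * (Cmod w / 2)))%R by field; lra.
rewrite /Rdiv. apply: Rmult_le_compat_l; first by have := Cmod_ge_0 h; nra.
apply: Rinv_le_contravar.
  apply: Rmult_lt_0_compat; nra.
apply: Rmult_le_compat_l => //. nra.
Qed.

Lemma holo_at_id z : holo_at (fun x => x) z.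
Proof. apply/holo_at_absring. eexists. exact: (is_derive_id (K := C_AbsRing)). Qed.

Lemma holo_at_const (c z : C) : holo_at (fun _ => c) z.
Proof. eexists. exact: (is_derive_const (K := C_AbsRing) (V := C_NormedModule)). Qed.

Lemma holo_at_qpow a z : holo_at (qpow a) z.
Proof.
pose w : C := RtoC (2 * PI * a) * Ci.
apply: (holo_at_of_remainder _ _ (qpow a z * w) (Cmod (qpow a z) * (3 * Cmod w ^ 2 * exp (Cmod w))) 1); first lra.
move=> h hh.
have -> : qpow a (z + h) = qpow a z * cexp (w * h).
  rewrite /qpow -cexp_add /w. congr cexp. ring.
replace (qpow a z * cexp (w * h) - qpow a z - qpow a z * w * h)
  with (qpow a z * (cexp (w * h) - 1 - w * h)) by ring.
rewrite Cmod_mult Rmult_assoc. apply: Rmult_le_compat_l; first exact: Cmod_ge_0.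
apply: Rle_trans; first exact: cexp_remainder.
have hw := Cmod_ge_0 w. have h0 := Cmod_ge_0 h.
have -> : Cmod (w * h) = (Cmod w * Cmod h)%R by exact: Cmod_mult.
have e : exp (Cmod w * Cmod h) <= exp (Cmod w) by apply: exp_le_compat; nra.
have -> : (3 * Cmod w ^ 2 * exp (Cmod w) * Cmod h ^ 2 = 3 * (Cmod w * Cmod h) ^ 2 * exp (Cmod w))%R by ring.
apply: Rmult_le_compat_l => //. have := pow2_ge_0 (Cmod w * Cmod h). lra.
Qed.

(** * Theta functions as q-series in tau *)

Definition qtheta (m k : R) (t : C) : C := theta (qpow (m / 2) t) (qpow k t).

Definition qtheta_exp (m k : R) (n : Z) : R := (IZR (n * n - n) * (m / 2) + IZR n * k)%R.

(** For n >= 0 the summand n k suffices; for n = -j < 0 the exponent is at least j (m - k). The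
    bounds on k and m hold in the cases used: m = 3 with k = 1, and m = 7 with k = 1, 2, 3. *)
Lemma qtheta_exp_ge m k n : 1 <= k -> k + 1 <= m -> INR (Z.abs_nat n) <= qtheta_exp m k n.
Proof.
move=> hk hm. rewrite /qtheta_exp INR_IZR_INZ Zabs2Nat.id_abs minus_IZR mult_IZR.
case: (Z_lt_le_dec n 0) => hn.
  rewrite Z.abs_neq; last lia. rewrite opp_IZR.
  have : (IZR n <= -1)%R by apply: IZR_le; lia. set x := IZR n => hx.
  have h0 : 0 <= x * x + x by nra.
  have h1 : 0 <= (x * x + x) * (m / 2) by apply: Rmult_le_pos; lra.
  have h2 : 0 <= - x * (m - k - 1) by apply: Rmult_le_pos; lra.
  lra.
rewrite Z.abs_eq //.
have h0 : 0 <= IZR n by apply: IZR_le.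
have h1 : 0 <= IZR n * IZR n - IZR n.
  case: (Z.eq_dec n 0) => [->|hn0]; first lra.
  have : (1 <= IZR n)%R by apply: IZR_le; lia. nra.
nra.
Qed.

Lemma zpow_m1_mod n : Cmod (zpow (-(1)) n) = 1%R.
Proof.
have h : forall j, Cmod ((-(1)) ^ j) = 1%R by move=> j; rewrite Cmod_pow Cmod_m1 pow1.
case: n => [|p|p] //=; first exact: Cmod_1.
rewrite Cmod_inv; first by rewrite h Rinv_1. apply: Cpow_nz. nz.
Qed.

Lemma qtheta_term m k t n :
  gterm (qpow (m / 2) t) (- qpow k t / qpow (m / 2) t) n = zpow (-(1)) n * qpow (qtheta_exp m k n) t.
Proof.
have hs := qpow_neq0 (m / 2) t. have hz := qpow_neq0 k t.
rewrite /gterm /qtheta_exp qpow_add !qpow_zpow.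
move: (qpow (m / 2) t) (qpow k t) hs hz => s z hs hz.
have -> : - z / s = (-(1)) * (z * / s) by rewrite /Cdiv; ring.
rewrite !zpow_mul_l //; try by nz.
have -> : (n * n - n = n * n + - n)%Z by lia.
rewrite zpow_inv // (zpow_add _ (n * n)) // (zpow_opp _ n) //. ring.
Qed.

Lemma qtheta_series m k t : qtheta m k t = ZS (fun n => zpow (-(1)) n * qpow (qtheta_exp m k n) t).
Proof. apply: ZS_ext => n. exact: qtheta_term. Qed.

Lemma qtheta_holo m k t : 1 <= k -> k + 1 <= m -> upper_half t -> holo_at (qtheta m k) t.
Proof.
move=> hk hm ht.
apply: (holo_at_ext (fun x => ZS (fun n => zpow (-(1)) n * qpow (qtheta_exp m k n) x))) => //.
  by move=> x _; rewrite qtheta_series.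
apply: qseries_holo => // n; [by rewrite zpow_m1_mod; lra|exact: qtheta_exp_ge].
Qed.

Lemma ZS_delta (f : Z -> C) : (forall n, n <> 0%Z -> f n = 0) -> ZS f = f 0%Z.
Proof.
move=> h. have e1 : csum (fz f) 1 = f 0%Z.
  rewrite /= /fz (h (- Z.of_nat 0 - 1)%Z) //. rewrite /=. ring.
apply: (CS_is (Cmod (f 0%Z)) 0).
- lra.
- move=> k. rewrite /fz (h (- Z.of_nat k - 1)%Z); last lia. rewrite Cplus_0_r.
  case: k => [|k]; first by rewrite /=; lra.
  rewrite (h (Z.of_nat (S k))); last lia. rewrite Cmod_0 pow_i; last lia. lra.
- rewrite -e1. apply: CS_finite => k hk. rewrite /fz !h; try lia. ring.
Qed.

Lemma Cmod_qpow_lt1 t : upper_half t -> Cmod (qpow 1 t) < 1.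
Proof.
rewrite /upper_half => h. rewrite Cmod_qpow -[X in _ < X]exp_0. apply: exp_increasing.
have := Rmult_lt_0_compat _ _ PI_RGT_0 h. lra.
Qed.

Lemma Cmod_qpow_pow a t : upper_half t -> forall n, INR n <= a -> Cmod (qpow a t) <= Cmod (qpow 1 t) ^ n.
Proof.
rewrite /upper_half => h n ha. rewrite !Cmod_qpow exp_pow. apply: exp_le_compat.
have := Rmult_lt_0_compat _ _ PI_RGT_0 h. nra.
Qed.

(** Remove the constant term 1. With x = |q| <= 1/2 the other terms are at most x^|n| <= 2 x
    (1/2)^|n|, and summing over Z multiplies the constant 2 x by 2 / (1 - 1/2) = 4. *)
Lemma qtheta_near1 m k t : 1 <= k -> k + 1 <= m -> upper_half t -> Cmod (qpow 1 t) <= /2 ->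
  Cmod (qtheta m k t - 1) <= 8 * Cmod (qpow 1 t).
Proof.
move=> hk hm ht hq. set x := Cmod (qpow 1 t) in hq *. have hx : 0 <= x by exact: Cmod_ge_0.
pose d (n : Z) : C := if (n =? 0)%Z then RtoC 1 else RtoC 0.
pose f n := zpow (-(1)) n * qpow (qtheta_exp m k n) t.
have f0 : f 0%Z = 1.
  rewrite /f /qtheta_exp /=. have -> : (0 * (m / 2) + 0 * k = 0)%R by ring. rewrite qpow_0. ring.
have hr : 0 <= /2 < 1 by lra.
have hg : zdom (2 * x) (/2) (fun n => f n - d n).
  move=> n. rewrite /d. case: (Z.eqb_spec n 0) => [->|hn].
    rewrite f0. replace (1 - 1) with (RtoC 0) by ring. rewrite Cmod_0 /=. lra.
  replace (f n - 0) with (f n) by ring. rewrite /f Cmod_mult zpow_m1_mod Rmult_1_l.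
  apply: Rle_trans; first exact: Cmod_qpow_pow t ht _ (qtheta_exp_ge m k n hk hm).
  have -> : Z.abs_nat n = S (Z.abs_nat n - 1) by lia.
  rewrite -/x /=. have := pow_incr x (/2) (Z.abs_nat n - 1) ltac:(lra). nra.
have hd : zdom 1 (/2) d.
  move=> n. rewrite /d. case: (Z.eqb_spec n 0) => [->|hn]; first by rewrite Cmod_1 /=; lra.
  rewrite Cmod_0. have : 0 <= (/2) ^ Z.abs_nat n by apply: pow_le; lra. lra.
have e : qtheta m k t = ZS (fun n => f n - d n) + 1.
  rewrite qtheta_series -[X in _ + X](ZS_delta d); last first.
    by move=> n hn; rewrite /d; case: (Z.eqb_spec n 0).
  rewrite -(ZS_plus (2 * x + 1) (/2)) //.
  - apply: ZS_ext => n. rewrite -/(f n). ring.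
  - apply: zdom_le hg; lra.
  - apply: zdom_le hd; lra.
rewrite e. replace (ZS (fun n => f n - d n) + 1 - 1) with (ZS (fun n => f n - d n)) by ring.
apply: Rle_trans; first exact: ZS_bound hr hg. right. field.
Qed.

(** * Evaluation of the products *)

Lemma cpow_Cpow z n : cpow z n = z ^ n.
Proof. elim: n => //= n ->. exact: Cmult_comm. Qed.

Lemma qpow_nat (a : R) n t : a = INR n -> qpow a t = qpow 1 t ^ n.
Proof. by move=> ->; rewrite -qpow_pow Rmult_1_r. Qed.

Lemma omq_pow m t : omq m t = 1 - qpow 1 t ^ m.
Proof. by rewrite /omq (qpow_nat _ m). Qed.

Section Evaluation.
Variable t : C.
Hypothesis ht : upper_half t.

Let q := qpow 1 t.

Lemma q_neq0 : q <> 0. Proof. exact: qpow_neq0. Qed.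

Lemma q_lt1 : Cmod q < 1. Proof. exact: Cmod_qpow_lt1. Qed.

Lemma qpow_lt1 a : (0 < a)%R -> Cmod (qpow a t) < 1.
Proof.
move=> ha. rewrite Cmod_qpow -[X in _ < X]exp_0. apply: exp_increasing.
have := Rmult_lt_0_compat _ _ PI_RGT_0 (Rmult_lt_0_compat _ _ ha ht). lra.
Qed.

Lemma q_pow_lt1 n : Cmod (q ^ S n) < 1.
Proof.
rewrite Cmod_pow. have h0 := Cmod_ge_0 q. have h1 := q_lt1.
have := pow_le_compat_exp (Cmod q) 1 (S n) ltac:(lra) ltac:(lia). rewrite [(_ ^ 1)%R]/=. lra.
Qed.

Lemma eta_qfac : eta t = qpow (1/24) t * qfac_inf q.
Proof. rewrite /eta. congr (_ * _). apply: Cprod_ext => k. exact: omq_pow. Qed.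

(** Product side of Euler's pentagonal number theorem: the factors grouped by residues mod 3 form
    the theta product with period q^3 at q. Through it eta shares the holomorphy and cusp estimates
    of [qtheta]. *)
Lemma qfac_qtheta : qfac_inf q = qtheta 3 1 t.
Proof.
have hs : qpow (3 / 2) t * qpow (3 / 2) t = q ^ 3.
  rewrite -qpow_add. apply: qpow_nat. rewrite /=. field.
have hr : 0 <= Cmod q < 1 by split; [exact: Cmod_ge_0|exact: q_lt1].
have hr3 : 0 <= Cmod (q ^ 3) < 1 by split; [exact: Cmod_ge_0|exact: q_pow_lt1].
have [K hK] := theta_factor_dom (q ^ 3) q (q_pow_lt1 2).
rewrite /qtheta theta_product; [|exact: qpow_neq0|apply: qpow_lt1; lra|exact: q_neq0].
rewrite hs -/q {1}/qfac_inf -(Cprod_group _ _ 3 _ _ hr (qfac_dom q)); last lia.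
rewrite /qfac_inf /theta_prod -(Cprod_mult _ _ _ _ _ hr3 (qfac_dom (q ^ 3)) hK).
apply: Cprod_ext => k.
rewrite /theta_factor -!Cpow_mult_r !pprod_S.
have -> : (3 * S k = 3 * k + 3)%nat by lia.
have -> : (S (3 * k + 0) = 3 * k + 1)%nat by lia.
have -> : (S (3 * k + 1) = 3 * k + 2)%nat by lia.
have -> : (S (3 * k + 2) = 3 * k + 3)%nat by lia.
rewrite !Cpow_add_r /=. field. exact: q_neq0.
Qed.

Lemma septic_product i j : (i + j = 7)%nat ->
  Cprod (fun k => omq (7 * k + i) t * omq (7 * k + j) t * omq (7 * k + 7) t) = qtheta 7 (INR i) t.
Proof.
move=> hij.
have hs : qpow (7 / 2) t * qpow (7 / 2) t = q ^ 7.
  rewrite -qpow_add. apply: qpow_nat. rewrite /=. field.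
have hr7 : 0 <= Cmod (q ^ 7) < 1 by split; [exact: Cmod_ge_0|exact: q_pow_lt1].
have [K hK] := theta_factor_dom (q ^ 7) (q ^ i) (q_pow_lt1 6).
have hqi : q ^ i <> 0 by apply: Cpow_nz; exact: q_neq0.
rewrite /qtheta theta_product; [|exact: qpow_neq0|apply: qpow_lt1; lra|exact: qpow_neq0].
rewrite hs (qpow_nat (INR i) i) // -/q.
rewrite /qfac_inf /theta_prod -(Cprod_mult _ _ _ _ _ hr7 (qfac_dom (q ^ 7)) hK).
apply: Cprod_ext => k.
rewrite !omq_pow -/q /theta_factor -!Cpow_mult_r.
have -> : (7 * S k = 7 * k + 7)%nat by lia.
rewrite !Cpow_add_r -[in q ^ 7]hij !Cpow_add_r. field. exact: hqi.
Qed.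

Lemma u_qtheta : u t = qpow (1/56) t * qtheta 7 3 t.
Proof. rewrite /u (septic_product 3 4) //. congr (_ * qtheta _ _ _). rewrite /=. ring. Qed.

Lemma v_qtheta : v t = qpow (9/56) t * qtheta 7 2 t.
Proof. by rewrite /v (septic_product 2 5). Qed.

Lemma w_qtheta : w t = qpow (25/56) t * qtheta 7 1 t.
Proof. by rewrite /w (septic_product 1 6). Qed.

(** The three theta products run through the residues 1, ..., 6 mod 7. Of the three factors (q^7;
    q^7)_infinity one supplies the residue 0, and two remain. *)
Lemma septic_product_all :
  qtheta 7 1 t * qtheta 7 2 t * qtheta 7 3 t = qfac_inf q * qfac_inf (q ^ 7) ^ 2.
Proof.
have hs : qpow (7 / 2) t * qpow (7 / 2) t = q ^ 7.
  rewrite -qpow_add. apply: qpow_nat. rewrite /=. field.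
have hr : 0 <= Cmod q < 1 by split; [exact: Cmod_ge_0|exact: q_lt1].
have hr7 : 0 <= Cmod (q ^ 7) < 1 by split; [exact: Cmod_ge_0|exact: q_pow_lt1].
have hr7' : 0 <= Cmod (q ^ 7) <= 1 by lra.
have [K1 h1] := theta_factor_dom (q ^ 7) (q ^ 1) (q_pow_lt1 6).
have [K2 h2] := theta_factor_dom (q ^ 7) (q ^ 2) (q_pow_lt1 6).
have [K3 h3] := theta_factor_dom (q ^ 7) (q ^ 3) (q_pow_lt1 6).
have h0 := qfac_dom (q ^ 7).
have e : qfac_inf q = qfac_inf (q ^ 7) * theta_prod (q ^ 7) (q ^ 1) *
    (theta_prod (q ^ 7) (q ^ 2) * theta_prod (q ^ 7) (q ^ 3)).
  rewrite /qfac_inf /theta_prod -(Cprod_mult _ _ _ _ _ hr7 h0 h1) -(Cprod_mult _ _ _ _ _ hr7 h2 h3).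
  rewrite -(Cprod_mult _ _ _ _ _ hr7 (geom_dom_prod _ _ _ _ _ hr7' h0 h1) (geom_dom_prod _ _ _ _ _ hr7' h2 h3)).
  rewrite -(Cprod_group _ _ 7 _ _ hr (qfac_dom q)); last lia.
  apply: Cprod_ext => k.
  rewrite /theta_factor -!Cpow_mult_r !pprod_S.
  have -> : (7 * S k = 7 * k + 7)%nat by lia.
  have -> : (S (7 * k + 0) = 7 * k + 1)%nat by lia.
  have -> : (S (7 * k + 1) = 7 * k + 2)%nat by lia.
  have -> : (S (7 * k + 2) = 7 * k + 3)%nat by lia.
  have -> : (S (7 * k + 3) = 7 * k + 4)%nat by lia.
  have -> : (S (7 * k + 4) = 7 * k + 5)%nat by lia.
  have -> : (S (7 * k + 5) = 7 * k + 6)%nat by lia.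
  have -> : (S (7 * k + 6) = 7 * k + 7)%nat by lia.
  rewrite !Cpow_add_r [pprod _ 0]/=. field. exact: q_neq0.
have th (a : R) i : a = INR i -> qtheta 7 a t = qfac_inf (q ^ 7) * theta_prod (q ^ 7) (q ^ i).
  move=> ha. rewrite /qtheta theta_product; [|exact: qpow_neq0|apply: qpow_lt1; lra|exact: qpow_neq0].
  by rewrite hs (qpow_nat a i).
rewrite (th 1%R 1%nat) // (th 2%R 2%nat) // (th 3%R 3%nat); last by rewrite /=; ring.
rewrite e. ring.
Qed.

Lemma qtheta_septic_neq0 : qtheta 7 1 t <> 0 /\ qtheta 7 2 t <> 0 /\ qtheta 7 3 t <> 0.
Proof.
have hs : qpow (7 / 2) t * qpow (7 / 2) t = q ^ 7.
  rewrite -qpow_add. apply: qpow_nat. rewrite /=. field.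
have := septic_neq0 q (qpow (7 / 2) t) q_neq0 q_lt1 hs.
by rewrite /qtheta (qpow_nat 2 2) // (qpow_nat 3 3) //=; ring.
Qed.

Lemma klein_relation :
  qtheta 7 3 t ^ 2 / qtheta 7 2 t + q * qtheta 7 1 t ^ 2 / qtheta 7 3 t = qtheta 7 2 t ^ 2 / qtheta 7 1 t.
Proof.
have hs : qpow (7 / 2) t * qpow (7 / 2) t = q ^ 7.
  rewrite -qpow_add. apply: qpow_nat. rewrite /=. field.
have := septic_linear q (qpow (7 / 2) t) q_neq0 q_lt1 hs.
by rewrite /qtheta (qpow_nat 2 2) // (qpow_nat 3 3) //=; ring.
Qed.

Lemma cubic_relation :
  let b := qtheta 7 2 t ^ 2 / qtheta 7 1 t in
  let c := q * qtheta 7 1 t ^ 2 / qtheta 7 3 t in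
  qfac_inf (q ^ 7) ^ 2 * (b ^ 3 - 8 * (b ^ 2 * c) + 5 * (b * c ^ 2) + c ^ 3) = qfac_inf q ^ 5.
Proof.
have hs : qpow (7 / 2) t * qpow (7 / 2) t = q ^ 7.
  rewrite -qpow_add. apply: qpow_nat. rewrite /=. field.
have := septic_cubic q (qpow (7 / 2) t) q_neq0 q_lt1 hs.
have e2 : theta (qpow (7 / 2) t) (q ^ 2) = qtheta 7 2 t by rewrite /qtheta (qpow_nat 2 2).
have e3 : theta (qpow (7 / 2) t) (q ^ 3) = qtheta 7 3 t.
  by rewrite /qtheta (qpow_nat 3 3) //=; ring.
rewrite e2 e3 -/(qtheta 7 1 t) septic_product_all => h b c.
have hP : qfac_inf (q ^ 7) <> 0 by apply: qfac_inf_neq0; [apply: Cpow_nz; exact: q_neq0|exact: q_pow_lt1].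
(* By [septic_product_all] the fifth power on the right contains the 10th power of this product,
   which cancels against the 12th. *)
transitivity (qfac_inf (q ^ 7) ^ 12 * (b ^ 3 - 8 * (b ^ 2 * c) + 5 * (b * c ^ 2) + c ^ 3) / qfac_inf (q ^ 7) ^ 10).
  by field.
rewrite h. by field.
Qed.

Lemma eta7_qfac : eta (RtoC 7 * t) = qpow (7/24) t * qfac_inf (q ^ 7).
Proof.
rewrite /eta qpow_scale. congr (qpow _ _ * _); first field.
apply: Cprod_ext => k. rewrite omq_pow qpow_scale (qpow_nat _ 7) //. rewrite /=. ring.
Qed.

End Evaluation.

(** * Behaviour at the cusp and the cube root *)

Lemma j7_cubic_identity (x y z e1 e7 : C) :
  x <> 0 -> y <> 0 -> z <> 0 -> e1 <> 0 -> e7 <> 0 ->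
  x - y + z = 0 -> x * y * z = e1 * e7 ^ 2 ->
  e7 ^ 2 * (y ^ 3 - 8 * (y ^ 2 * z) + 5 * (y * z ^ 2) + z ^ 3) = e1 ^ 5 ->
  (e7 ^ 2 / e1 * (/ x - / y + / z)) ^ 3 = (e1 / e7) ^ 4 + 13 + 49 * (/ (e1 / e7)) ^ 4.
Proof.
move=> hx hy hz h1 h7 hlin hprod hcub.
have ey : y = x + z by replace y with (y + (x - y + z)) by (rewrite hlin; ring); ring.
have eS : / x - / y + / z = (x ^ 2 + x * z + z ^ 2) / (e1 * e7 ^ 2).
  rewrite -hprod ey. field. by rewrite -ey.
rewrite eS.
have eN : y ^ 3 - 8 * (y ^ 2 * z) + 5 * (y * z ^ 2) + z ^ 3 = e1 ^ 5 / e7 ^ 2 by rewrite -hcub; field.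
(* With N the cubic form and y = x + z, the polynomial identity (x^2 + xz + z^2)^3 = N^2 + 13 N xyz
   + 49 (xyz)^2 is the source of the constants 13 and 49; dividing by e1^6 gives the three terms of
   [j7star]. *)
have e : (x ^ 2 + x * z + z ^ 2) ^ 3
  = (e1 ^ 5 / e7 ^ 2) ^ 2 + 13 * (e1 ^ 5 / e7 ^ 2) * (e1 * e7 ^ 2) + 49 * (e1 * e7 ^ 2) ^ 2.
  rewrite -eN -hprod ey. ring.
transitivity ((x ^ 2 + x * z + z ^ 2) ^ 3 / e1 ^ 6); first by field; split.
rewrite e. field. by split.
Qed.

(** The bound 0 <= T keeps the region inside the upper half-plane, where the product formulas
    hold. *)
Definition bigOq (g : C -> C) : Prop :=
  exists M T : R, 0 <= T /\ forall t, T < Im t -> Cmod (g t) <= M * Cmod (qpow 1 t).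

Definition near1 (f : C -> C) : Prop := bigOq (fun t => f t - 1).

Definition bounded_at_cusp (f : C -> C) : Prop :=
  exists B T : R, 0 <= T /\ forall t, T < Im t -> Cmod (f t) <= B.

(** The crude bound exp x >= 1 + x already gives |q| <= 1 / (2 pi Im t), so 1/e is a possible
    threshold. *)
Lemma Cmod_q_small (e : R) : (0 < e)%R ->
  exists T, 0 <= T /\ forall t, T < Im t -> upper_half t /\ Cmod (qpow 1 t) <= e.
Proof.
move=> he. have hi : (0 < / e)%R by exact: Rinv_0_lt_compat.
exists (/ e)%R. split; first lra. move=> t ht. have hY : (0 < Im t)%R by lra. split => //.
rewrite Cmod_qpow exp_Ropp -(Rinv_inv e). apply: Rinv_le_contravar => //.
have := exp_ineq1_le (2 * PI * 1 * Im t). have := PI2_1. nra.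
Qed.

Lemma bigOq_ext f g : (forall t, upper_half t -> f t = g t) -> bigOq f -> bigOq g.
Proof.
move=> h [M [T [hT H]]]. exists M, T. split => // t ht. rewrite -h; first exact: H.
rewrite /upper_half. lra.
Qed.

Lemma bigOq_plus f g : bigOq f -> bigOq g -> bigOq (fun t => f t + g t).
Proof.
move=> [M [T [hT H]]] [M' [T' [hT' H']]]. exists (M + M')%R, (Rmax T T').
split; first by apply: Rle_trans hT (Rmax_l _ _).
move=> t ht. have := Rmax_l T T'. have := Rmax_r T T'.
move=> r1 r2. have h1 := H t ltac:(lra). have h2 := H' t ltac:(lra).
have := Cmod_triangle (f t) (g t). lra.
Qed.

Lemma bigOq_mult f g : bigOq f -> bounded_at_cusp g -> bigOq (fun t => f t * g t).
Proof.
move=> [M [T [hT H]]] [B [T' [hT' H']]]. exists (M * B)%R, (Rmax T T').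
split; first by apply: Rle_trans hT (Rmax_l _ _).
move=> t ht. have := Rmax_l T T'. have := Rmax_r T T'.
move=> r1 r2. have h1 := H t ltac:(lra). have h2 := H' t ltac:(lra).
rewrite Cmod_mult. have := Rmult_le_compat _ _ _ _ (Cmod_ge_0 (f t)) (Cmod_ge_0 (g t)) h1 h2. lra.
Qed.

Lemma near1_between f : near1 f ->
  exists T, 0 <= T /\ forall t, T < Im t -> /2 <= Cmod (f t) <= 2.
Proof.
move=> [M [T [hT H]]].
have hM : (0 < / (2 * (Rabs M + 1)))%R by apply: Rinv_0_lt_compat; have := Rabs_pos M; lra.
have [T' [hT' H']] := Cmod_q_small _ hM. exists (Rmax T T').
split; first by apply: Rle_trans hT (Rmax_l _ _).
move=> t ht. have := Rmax_l T T'. have := Rmax_r T T'. move=> r1 r2.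
have h1 := H t ltac:(lra). have [_ h2] := H' t ltac:(lra).
have h3 : M * Cmod (qpow 1 t) <= /2.
  apply: (Rle_trans _ ((Rabs M + 1) * Cmod (qpow 1 t))).
    apply: Rmult_le_compat_r; first exact: Cmod_ge_0. have := Rle_abs M. lra.
  apply: (Rle_trans _ ((Rabs M + 1) * / (2 * (Rabs M + 1)))).
    apply: Rmult_le_compat_l => //. have := Rabs_pos M. lra.
  right. field. have := Rabs_pos M. lra.
have h4 := Cmod_triangle (f t - 1) 1. rewrite Cmod_1 in h4.
replace (f t - 1 + 1) with (f t) in h4 by ring.
have h5 := Cmod_triangle (f t) (- (f t - 1)). rewrite Cmod_opp in h5.
replace (f t + - (f t - 1)) with (RtoC 1) in h5 by ring. rewrite Cmod_1 in h5. lra.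
Qed.

Lemma near1_bounded f : near1 f -> bounded_at_cusp f.
Proof.
move=> /near1_between [T [hT H]]. exists 2%R, T. split => // t ht. by have [] := H t ht.
Qed.

Lemma near1_mult f g : near1 f -> near1 g -> near1 (fun t => f t * g t).
Proof.
move=> hf hg. apply: (bigOq_ext (fun t => (f t - 1) * g t + (g t - 1))); first by move=> t _; ring.
apply: bigOq_plus (hg). apply: bigOq_mult (hf) _. exact: near1_bounded.
Qed.

Lemma near1_inv f : near1 f -> (forall t, upper_half t -> f t <> 0) -> near1 (fun t => / f t).
Proof.
move=> hf h0. apply: (bigOq_ext (fun t => (f t - 1) * (- / f t))).
  by move=> t ht; field; exact: h0.
apply: bigOq_mult (hf) _. have [T [hT H]] := near1_between f hf.
exists 2%R, T. split => // t ht. have [h1 _] := H t ht.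
rewrite Cmod_opp Cmod_inv; last by apply: h0; rewrite /upper_half; lra.
replace 2%R with (/ / 2)%R by lra. apply: Rinv_le_contravar; lra.
Qed.

Lemma near1_add f g : near1 f -> bigOq g -> near1 (fun t => f t + g t).
Proof.
move=> hf hg. apply: (bigOq_ext (fun t => (f t - 1) + g t)); first by move=> t _; ring.
exact: bigOq_plus.
Qed.

Lemma bigOq_q : bigOq (qpow 1).
Proof. exists 1%R, 0%R. split; [lra|move=> t _; lra]. Qed.

Lemma bounded_minus f g : bounded_at_cusp f -> bounded_at_cusp g -> bounded_at_cusp (fun t => f t - g t).
Proof.
move=> [M [T [hT H]]] [M' [T' [hT' H']]]. exists (M + M')%R, (Rmax T T').
split; first by apply: Rle_trans hT (Rmax_l _ _).
move=> t ht. have := Rmax_l T T'. have := Rmax_r T T'.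
move=> r1 r2. have h1 := H t ltac:(lra). have h2 := H' t ltac:(lra).
have := Cmod_triangle (f t) (- g t). rewrite Cmod_opp /Cminus. lra.
Qed.

Lemma qtheta_near1_cusp m k : 1 <= k -> k + 1 <= m -> near1 (qtheta m k).
Proof.
move=> hk hm. have [T [hT H]] := Cmod_q_small (/2) ltac:(lra).
exists 8%R, T. split => // t ht. have [h1 h2] := H t ht. exact: qtheta_near1.
Qed.

Lemma upper_half_scale7 t : upper_half t -> upper_half (RtoC 7 * t).
Proof. rewrite /upper_half. case: t => x y /=. lra. Qed.

Lemma near1_scale7 f : near1 f -> near1 (fun t => f (RtoC 7 * t)).
Proof.
move=> [M [T [hT H]]]. exists (Rabs M), T. split => // t ht.
have hY : upper_half t by rewrite /upper_half; lra.
have e : Im (RtoC 7 * t) = (7 * Im t)%R by case: (t) => x y /=; ring.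
apply: Rle_trans; first by apply: H; rewrite e; lra.
rewrite qpow_scale.
have h1 : Cmod (qpow (7 * 1) t) <= Cmod (qpow 1 t).
  have := Cmod_qpow_pow (7 * 1) t hY 1%nat ltac:(rewrite /=; lra). by rewrite pow_1.
have h0 := Cmod_ge_0 (qpow (7 * 1) t). have := Rle_abs M. have := Rabs_pos M. nra.
Qed.

Lemma holo_at_scale7 f t : holo_at f (RtoC 7 * t) -> holo_at (fun x => f (RtoC 7 * x)) t.
Proof.
move=> hf. apply: (holo_at_comp f (fun x => RtoC 7 * x)) => //.
apply: (holo_at_mult (fun _ => RtoC 7) (fun x => x)); [exact: holo_at_const|exact: holo_at_id].
Qed.

Lemma eta_qtheta t : upper_half t -> eta t = qpow (1/24) t * qtheta 3 1 t.
Proof. by move=> ht; rewrite eta_qfac -(qfac_qtheta t ht). Qed.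

Lemma qtheta_eta_neq0 t : upper_half t -> qtheta 3 1 t <> 0.
Proof. move=> ht. rewrite -qfac_qtheta //. apply: qfac_inf_neq0; [exact: q_neq0|exact: q_lt1]. Qed.

Lemma holo_at_qtheta_mult a m k (f : C -> C) t : 1 <= k -> k + 1 <= m -> upper_half t ->
  (forall x, upper_half x -> f x = qpow a x * qtheta m k x) -> holo_at f t.
Proof.
move=> hk hm ht h. apply: (holo_at_ext (fun x => qpow a x * qtheta m k x)) => //.
  by move=> x hx; rewrite h.
apply: holo_at_mult; [exact: holo_at_qpow|exact: qtheta_holo].
Qed.

(** * The explicit cube root of [j7star] *)

Definition theta_sum (t : C) : C :=
  v t / u t ^ 2 - w t / v t ^ 2 + u t / w t ^ 2.

Definition cube_root (t : C) : C := eta (RtoC 7 * t) ^ 2 / eta t * theta_sum t.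

Lemma uvw_eta_neq0 t : upper_half t ->
  u t <> 0 /\ v t <> 0 /\ w t <> 0 /\ eta t <> 0 /\ eta (RtoC 7 * t) <> 0.
Proof.
move=> ht. have [h1 [h2 h3]] := qtheta_septic_neq0 t ht.
have ht7 := upper_half_scale7 t ht.
rewrite u_qtheta // v_qtheta // w_qtheta // eta_qtheta // eta_qtheta //.
by repeat split; apply: Cmult_neq_0 => //; try exact: qpow_neq0; apply: qtheta_eta_neq0.
Qed.

Lemma holo_uvw_eta t : upper_half t ->
  holo_at u t /\ holo_at v t /\ holo_at w t /\ holo_at eta t.
Proof.
move=> ht. split; last split; last split.
- by apply: (holo_at_qtheta_mult (1/56) 7 3) => //; try lra; exact: u_qtheta.
- by apply: (holo_at_qtheta_mult (9/56) 7 2) => //; try lra; exact: v_qtheta.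
- by apply: (holo_at_qtheta_mult (25/56) 7 1) => //; try lra; exact: w_qtheta.
- by apply: (holo_at_qtheta_mult (1/24) 3 1) => //; try lra; exact: eta_qtheta.
Qed.

Lemma cube_root_holo t : upper_half t -> holo_at cube_root t.
Proof.
move=> ht. have [hu [hv [hw he]]] := holo_uvw_eta t ht.
have [nu [nv [nw [ne ne7]]]] := uvw_eta_neq0 t ht.
have [_ [_ [_ he7]]] := holo_uvw_eta _ (upper_half_scale7 t ht).
have sq f : holo_at f t -> holo_at (fun x => f x ^ 2) t.
  move=> hf. rewrite /=. apply: holo_at_mult => //. apply: holo_at_mult => //. exact: holo_at_const.
have qt f g : holo_at f t -> holo_at g t -> g t <> 0 -> holo_at (fun x => f x / g x ^ 2) t.
  move=> hf hg h0. apply: holo_at_mult => //. apply: holo_at_inv; [exact: Cpow_nz|exact: sq].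
apply: holo_at_mult.
  apply: holo_at_mult; last exact: holo_at_inv.
  apply: (sq (fun x => eta (RtoC 7 * x))). exact: holo_at_scale7.
apply: holo_at_plus; last exact: qt. apply: holo_at_minus; exact: qt.
Qed.

Lemma uvw_relations t : upper_half t ->
  let x := u t ^ 2 / v t in let y := v t ^ 2 / w t in let z := w t ^ 2 / u t in
  x - y + z = 0 /\ x * y * z = eta t * eta (RtoC 7 * t) ^ 2 /\
  eta (RtoC 7 * t) ^ 2 * (y ^ 3 - 8 * (y ^ 2 * z) + 5 * (y * z ^ 2) + z ^ 3) = eta t ^ 5.
Proof.
move=> ht x y z.
have hrel := klein_relation t ht. have hcub := cubic_relation t ht. have hprod := septic_product_all t ht.
cbv zeta in hcub.
have [h1 [h2 h3]] := qtheta_septic_neq0 t ht.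
rewrite /x /y /z u_qtheta // v_qtheta // w_qtheta // eta7_qfac eta_qfac.
(* 168 is the least common multiple of 56 and 24, so every fractional power of q in u, v, w and eta
   becomes a natural power of one nonzero number, within reach of [field]. *)
set rho := qpow (1 / 168) t.
have hrho : rho <> 0 by exact: qpow_neq0.
have pw (a : R) n : (a * 168 = INR n)%R -> qpow a t = rho ^ n.
  move=> ha. rewrite /rho -qpow_pow. congr qpow. lra.
have r168 : qpow 1 t = rho ^ 168 by apply: pw; rewrite INR_IZR_INZ /=; lra.
rewrite (pw (1/56)%R 3%nat); last by rewrite INR_IZR_INZ /=; lra.
rewrite (pw (9/56)%R 27%nat); last by rewrite INR_IZR_INZ /=; lra.
rewrite (pw (25/56)%R 75%nat); last by rewrite INR_IZR_INZ /=; lra.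
rewrite (pw (1/24)%R 7%nat); last by rewrite INR_IZR_INZ /=; lra.
rewrite (pw (7/24)%R 49%nat); last by rewrite INR_IZR_INZ /=; lra.
move: hrel hcub hprod. rewrite r168.
set P1 := qfac_inf (rho ^ 168). set P7 := qfac_inf _.
move: (qtheta 7 1 t) (qtheta 7 2 t) (qtheta 7 3 t) h1 h2 h3 => W V U hW hV hU hrel hcub hprod.
move: P1 P7 hcub hprod => P1 P7 hcub hprod.
(* All three quotients share the factor rho^(-21) = q^(-1/8). Homogeneous relations therefore carry
   over, and the remaining powers match the eta factors: 168 - 63 = 105 = 7 + 2 * 49 for the
   product, 98 - 63 = 35 = 5 * 7 for the cubic. *)
have ex : (rho ^ 3 * U) ^ 2 / (rho ^ 27 * V) = / rho ^ 21 * (U ^ 2 / V) by field; split.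
have ey : (rho ^ 27 * V) ^ 2 / (rho ^ 75 * W) = / rho ^ 21 * (V ^ 2 / W) by field; split.
have ez : (rho ^ 75 * W) ^ 2 / (rho ^ 3 * U) = / rho ^ 21 * (rho ^ 168 * W ^ 2 / U) by field; split.
rewrite ex ey ez. split; last split.
- rewrite -hrel. field. by repeat split.
- transitivity (rho ^ 105 * (W * V * U)); first by field; repeat split.
  rewrite hprod. ring.
- transitivity (rho ^ 35 * (P7 ^ 2 * ((V ^ 2 / W) ^ 3 - 8 * ((V ^ 2 / W) ^ 2 * (rho ^ 168 * W ^ 2 / U))
    + 5 * (V ^ 2 / W * (rho ^ 168 * W ^ 2 / U) ^ 2) + (rho ^ 168 * W ^ 2 / U) ^ 3))).
    move: (V ^ 2 / W) (rho ^ 168 * W ^ 2 / U) => b c. field. done.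
  rewrite hcub. ring.
Qed.

Lemma cube_root_cubed t : upper_half t -> cube_root t ^ 3 = j7star t.
Proof.
move=> ht. have [nu [nv [nw [ne ne7]]]] := uvw_eta_neq0 t ht.
have [r1 [r2 r3]] := uvw_relations t ht.
have e := j7_cubic_identity (u t ^ 2 / v t) (v t ^ 2 / w t) (w t ^ 2 / u t) _ _ ltac:(by nz) ltac:(by nz) ltac:(by nz) ne ne7 r1 r2 r3.
rewrite /j7star !cpow_Cpow -e /cube_root /theta_sum. congr (_ ^ 3). congr (_ * _).
field. by repeat split.
Qed.

Lemma cube_root_cusp : near1 (fun t => qpow (1/3) t * cube_root t).
Proof.
have nU : near1 (qtheta 7 3) by apply: qtheta_near1_cusp; lra.
have nV : near1 (qtheta 7 2) by apply: qtheta_near1_cusp; lra.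
have nW : near1 (qtheta 7 1) by apply: qtheta_near1_cusp; lra.
have nE : near1 (qtheta 3 1) by apply: qtheta_near1_cusp; lra.
have nE7 := near1_scale7 _ nE.
have nEi := near1_inv _ nE qtheta_eta_neq0.
have nUi := near1_inv _ nU (fun t ht => proj2 (proj2 (qtheta_septic_neq0 t ht))).
have nVi := near1_inv _ nV (fun t ht => proj1 (proj2 (qtheta_septic_neq0 t ht))).
have nWi := near1_inv _ nW (fun t ht => proj1 (qtheta_septic_neq0 t ht)).
have nVU := near1_mult _ _ nV (near1_mult _ _ nUi nUi).
have nWV := near1_mult _ _ nW (near1_mult _ _ nVi nVi).
have nUW := near1_mult _ _ nU (near1_mult _ _ nWi nWi).
(* The term u/w^2 leads, with exponent -147/168; v/u^2 and w/v^2 both start at 21/168, a full power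
   of q higher. Together with 91/168 from the eta quotient the leading exponent is -56/168 =
   -1/3. *)
have nsum := near1_add _ _ nUW (bigOq_mult _ _ bigOq_q (bounded_minus _ _ (near1_bounded _ nVU) (near1_bounded _ nWV))).
apply: (bigOq_ext _ _ _ (near1_mult _ _ (near1_mult _ _ (near1_mult _ _ nE7 nE7) nEi) nsum)).
move=> t ht. congr (_ - _). rewrite /cube_root /theta_sum.
have [h1 [h2 h3]] := qtheta_septic_neq0 t ht. have hE := qtheta_eta_neq0 t ht.
rewrite u_qtheta // v_qtheta // w_qtheta // (eta_qtheta t) // eta_qtheta; last exact: upper_half_scale7.
set rho := qpow (1 / 168) t.
have hrho : rho <> 0 by exact: qpow_neq0.
have pw (a : R) n : (a * 168 = INR n)%R -> qpow a t = rho ^ n.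
  move=> ha. rewrite /rho -qpow_pow. congr qpow. lra.
rewrite (qpow_scale (1/24) 7).
rewrite (pw 1%R 168%nat); last by rewrite INR_IZR_INZ /=; lra.
rewrite (pw (1/56)%R 3%nat); last by rewrite INR_IZR_INZ /=; lra.
rewrite (pw (9/56)%R 27%nat); last by rewrite INR_IZR_INZ /=; lra.
rewrite (pw (25/56)%R 75%nat); last by rewrite INR_IZR_INZ /=; lra.
rewrite (pw (1/24)%R 7%nat); last by rewrite INR_IZR_INZ /=; lra.
rewrite (pw (7 * (1/24))%R 49%nat); last by rewrite INR_IZR_INZ /=; lra.
rewrite (pw (1/3)%R 56%nat); last by rewrite INR_IZR_INZ /=; lra.
field. by repeat split.
Qed.

Theorem theorem1 :
  (forall tau : C, upper_half tau ->
     Cplus (Cminus (Cdiv (cpow (u tau) 2) (v tau)) (Cdiv (cpow (v tau) 2) (w tau)))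
           (Cdiv (cpow (w tau) 2) (u tau)) = RtoC 0) /\
  (exists c : C -> C, j7star_cube_root c /\
     forall tau : C, upper_half tau ->
       Cplus (Cminus (Cdiv (v tau) (cpow (u tau) 2)) (Cdiv (w tau) (cpow (v tau) 2)))
             (Cdiv (u tau) (cpow (w tau) 2))
       = Cmult (Cdiv (eta tau) (cpow (eta (Cmult (RtoC 7) tau)) 2)) (c tau)).
Proof.
split.
  move=> tau ht. rewrite !cpow_Cpow. by have [] := uvw_relations tau ht.
exists cube_root. split; last first.
  move=> tau ht. have [nu [nv [nw [ne ne7]]]] := uvw_eta_neq0 tau ht.
  rewrite !cpow_Cpow /cube_root /theta_sum. field. by repeat split.
split; first exact: cube_root_holo. split.
  move=> tau ht. rewrite cpow_Cpow. exact: cube_root_cubed.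
have [M [T [_ H]]] := cube_root_cusp. by exists M, T.
Qed.
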